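(* Let $(G,\{A_v,\mathcal{L}_v,L_v,\rho_v\}_{v\in V},\{\phi_e\}_{e\in E})$ be a noncommutative Mauldin-Williams graph. Suppose that the graph $G$ has no sinks, and that for every $v\in V$ the state space $\mathcal{S}_v$ of $A_v$ equals the closed convex hull of $K_v$, where $(K_v)_{v\in V}$ is the unique invariant family of nonempty compact sets for the dual maps $\phi_e^*$. Let $A=\bigoplus_{v\in V}A_v$. Then there is an injective $*$-homomorphism from $A$ into $C(E^\infty)$, where $E^\infty$ is the infinite path space of $G$.
   Context: Graphs. A graph $G=(V,E,r,s)$ consists of finite sets $V$ and $E$ and maps $r,s:E\to V$ (range and source). No sinks means $s$ is surjective. The infinite path space is $E^\infty=\{(\alpha_i)_{i\in\mathbb{N}}:\alpha_i\in E,\ r(\alpha_i)=s(\alpha_{i+1})\text{ for all }i\}$, with the compact topology inherited from the product $E^{\mathbb{N}}$ of discrete spaces. Rieffel metric. Let $A$ be a unital $C^*$-algebra, $\mathcal{L}(A)\subset A$ a dense subspace (Lipschitz elements) and $L$ a seminorm on $\mathcal{L}(A)$ (Lipschitz seminorm) such that $\{a\in\mathcal{L}(A):L(a)=0\}$ is exactly the set of scalar multiples of the identity. The Rieffel metric on the state space $\mathcal{S}$ of $A$ is $\rho(\mu,\nu)=\sup\{|\mu(a)-\nu(a)|:a\in\mathcal{L}(A),\ L(a)\le1\}$. It is always assumed that $\rho$ is bounded on $\mathcal{S}$ and that its topology is the weak-$*$ topology on $\mathcal{S}$. Noncommutative Mauldin-Williams graph. A system $(G,\{A_v,\mathcal{L}_v,L_v,\rho_v\}_{v\in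 V},\{\phi_e\}_{e\in E})$ where $G=(V,E,r,s)$ is a graph; each $A_v$ is a (nonzero) unital $C^*$-algebra with a Lipschitz seminorm $L_v$ on a subspace $\mathcal{L}_v\subset A_v$ of Lipschitz elements, and $\rho_v$ is the corresponding Rieffel metric on the state space $\mathcal{S}_v$ of $A_v$; and for each $e\in E$, $\phi_e:A_{s(e)}\to A_{r(e)}$ is a unital $*$-homomorphism with $\rho_{s(e)}(\phi_e^*(\mu),\phi_e^*(\nu))\le c\,\rho_{r(e)}(\mu,\nu)$ for all $\mu,\nu\in\mathcal{S}_{r(e)}$, for some constant $0<c<1$ (independent of $e$). Here $\phi_e^*(\mu)=\mu\circ\phi_e$. Invariant family. When $G$ has no sinks there is a unique family $(K_v)_{v\in V}$ of nonempty (weak-$*$) compact sets $K_v\subset\mathcal{S}_v$ with $K_v=\bigcup_{e\in E,\,s(e)=v}\phi_e^*(K_{r(e)})$ for all $v\in V$. *)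

(* Defs.v *)
From HB Require Import structures.
From mathcomp Require Import all_boot all_order all_algebra.
From mathcomp Require Import all_classical all_reals all_analysis.
From mathcomp Require Import complex.

Set Implicit Arguments.
Unset Strict Implicit.
Unset Printing Implicit Defensive.

Import Order.TTheory GRing.Theory Num.Theory.
Import numFieldNormedType.Exports.

Local Open Scope classical_set_scope.
Local Open Scope ring_scope.

HB.instance Definition _ (R : realType) := NormedModule.copy R[i] R[i]^o.

HB.mixin Record hasStar A := { star : A -> A }.

#[short(type="starType")]
HB.structure Definition Star := { A of hasStar A }.

(* The product is part of this mixin and becomes a ring structure below: a class
   inheriting from both normed modules and rings would have to be declared
   before [numDomainType]. *)
HB.mixin Record isCStarAlgebra (R : realType) A
    of CompleteNormedModule R[i] A & hasStar A := {
  cstar_one : A ;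
  cstar_mul : A -> A -> A ;
  cstar_mulA : associative cstar_mul ;
  cstar_mul1 : left_id cstar_one cstar_mul ;
  cstar_mulr1 : right_id cstar_one cstar_mul ;
  cstar_mulDl : left_distributive cstar_mul +%R ;
  cstar_mulDr : right_distributive cstar_mul +%R ;
  cstar_one_neq0 : cstar_one != 0 ;
  cstar_scaleAl : forall (k : R[i]) (a b : A),
    k *: cstar_mul a b = cstar_mul (k *: a) b ;
  cstar_scaleAr : forall (k : R[i]) (a b : A),
    k *: cstar_mul a b = cstar_mul a (k *: b) ;
  starK : involutive (star : A -> A) ;
  starD : forall a b : A, star (a + b) = star a + star b ;
  starZ : forall (k : R[i]) (a : A), star (k *: a) = conjc k *: star a ;
  cstar_starM : forall a b : A,
    star (cstar_mul a b) = cstar_mul (star b) (star a) ;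
  cstar_normM : forall a b : A, `|cstar_mul a b| <= `|a| * `|b| ;
  cstar_identity : forall a : A, `|cstar_mul (star a) a| = `|a| ^+ 2
}.

(* nonzero unital C*-algebras *)
#[short(type="cstarAlgType")]
HB.structure Definition CStarAlgebra (R : realType) :=
  { A of CompleteNormedModule R[i] A & hasStar A & isCStarAlgebra R A }.

Section CStarRing.
Variables (R : realType) (A : cstarAlgType R).

#[non_forgetful_inheritance]
HB.instance Definition _ := GRing.Zmodule_isNzRing.Build (CStarAlgebra.sort A)
  cstar_mulA cstar_mul1 cstar_mulr1 cstar_mulDl cstar_mulDr cstar_one_neq0.
#[non_forgetful_inheritance]
HB.instance Definition _ :=
  GRing.Lmodule_isLalgebra.Build R[i] (CStarAlgebra.sort A) cstar_scaleAl.
#[non_forgetful_inheritance]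
HB.instance Definition _ :=
  GRing.Lalgebra_isAlgebra.Build R[i] (CStarAlgebra.sort A) cstar_scaleAr.

End CStarRing.

(* Not necessarily unital. This is a notation because the direct sum of an empty
   family and the functions on an empty space are the zero algebra, which is
   both a [pzRingType] and an [lmodType] but not an [algType]. *)
Notation star_hom f :=
  [/\ linear f, {morph f : a b / a * b} & {morph f : a / star a}].

Section DirectSum.
Variables (R : realType) (I : finType) (A : I -> cstarAlgType R).

Definition direct_sum : Type := forall i, A i.

HB.instance Definition _ := gen_eqMixin direct_sum.
HB.instance Definition _ := gen_choiceMixin direct_sum.

Implicit Types a b c : direct_sum.

Let add a b : direct_sum := fun i => a i + b i.
Let opp a : direct_sum := fun i => - a i.
Let zero : direct_sum := fun i => 0.
Let mul a b : direct_sum := fun i => a i * b i.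
Let one : direct_sum := fun i => 1.
Let scale (k : R[i]) a : direct_sum := fun i => k *: a i.
Let dstar a : direct_sum := fun i => star (a i).

Let addA : associative add.
Proof. by move=> a b c; apply: functional_extensionality_dep => i; exact: addrA. Qed.
Let addC : commutative add.
Proof. by move=> a b; apply: functional_extensionality_dep => i; exact: addrC. Qed.
Let add0 : left_id zero add.
Proof. by move=> a; apply: functional_extensionality_dep => i; exact: add0r. Qed.
Let addN : left_inverse zero opp add.
Proof. by move=> a; apply: functional_extensionality_dep => i; exact: addNr. Qed.

HB.instance Definition _ :=
  GRing.isZmodule.Build direct_sum addA addC add0 addN.

Let mulA : associative mul.
Proof. by move=> a b c; apply: functional_extensionality_dep => i; exact: mulrA. Qed.
Let mul1 : left_id one mul.
Proof. by move=> a; apply: functional_extensionality_dep => i; exact: mul1r. Qed.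
Let mulr1' : right_id one mul.
Proof. by move=> a; apply: functional_extensionality_dep => i; exact: mulr1. Qed.
Let mulDl : left_distributive mul +%R.
Proof. by move=> a b c; apply: functional_extensionality_dep => i; exact: mulrDl. Qed.
Let mulDr : right_distributive mul +%R.
Proof. by move=> a b c; apply: functional_extensionality_dep => i; exact: mulrDr. Qed.

HB.instance Definition _ :=
  GRing.Zmodule_isPzRing.Build direct_sum mulA mul1 mulr1' mulDl mulDr.

Let scaleA k l a : scale k (scale l a) = scale (k * l) a.
Proof. by apply: functional_extensionality_dep => i; exact: scalerA. Qed.
Let scale1 : left_id 1 scale.
Proof. by move=> a; apply: functional_extensionality_dep => i; exact: scale1r. Qed.
Let scaleDr : right_distributive scale +%R.
Proof. by move=> k a b; apply: functional_extensionality_dep => i; exact: scalerDr. Qed.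
Let scaleDl a : {morph scale^~ a : k l / k + l}.
Proof. by move=> k l; apply: functional_extensionality_dep => i; exact: scalerDl. Qed.

HB.instance Definition _ := GRing.Zmodule_isLmodule.Build R[i] direct_sum
  scaleA scale1 scaleDr scaleDl.

HB.instance Definition _ := hasStar.Build direct_sum dstar.

End DirectSum.

Section ContinuousFunctions.
Variables (R : realType) (X : topologicalType).

Definition continuousC : {pred X -> R[i]} :=
  mem [set f : X -> R[i] | continuous f].

Lemma continuousC_subring_closed : subring_closed continuousC.
Proof.
split=> [|f g /set_mem cf /set_mem cg|f g /set_mem cf /set_mem cg];
  apply/mem_set => x.
- exact: cvg_cst.
- by apply: cvgB; [exact: cf | exact: cg].
- by apply: cvgM; [exact: cf | exact: cg].
Qed.

Lemma continuousC_scaler_closed : GRing.scaler_closed continuousC.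
Proof.
by move=> k f /set_mem cf; apply/mem_set => x; apply: cvgZl_tmp; exact: cf.
Qed.

HB.instance Definition _ :=
  GRing.isSubringClosed.Build _ continuousC continuousC_subring_closed.
HB.instance Definition _ :=
  GRing.isScaleClosed.Build _ _ continuousC continuousC_scaler_closed.

Record Cfun := MkCfun { Cfun_fun :> X -> R[i] ; _ : Cfun_fun \in continuousC }.

HB.instance Definition _ := [isSub for Cfun_fun].
HB.instance Definition _ := [Choice of Cfun by <:].
HB.instance Definition _ :=
  GRing.SubChoice_isSubPzRing.Build _ _ Cfun continuousC_subring_closed.
HB.instance Definition _ := [SubZmodule_isSubLmodule of Cfun by <:].

Lemma continuousC_conj (f : Cfun) : conjc \o f \in continuousC.
Proof.
apply/mem_set => x; apply/cvgrPdist_lt => e e0.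
have /cvgrPdist_lt /(_ e e0) := set_mem (valP f) x.
by apply: filterS => y; rewrite /= -rmorphB /= !normc_def; case: (_ - _) => u v /=;
  rewrite sqrrN.
Qed.

Let cstar (f : Cfun) : Cfun := MkCfun (continuousC_conj f).

HB.instance Definition _ := hasStar.Build Cfun cstar.

End ContinuousFunctions.

Section States.
Variables (R : realType) (A : cstarAlgType R).

(* [0 <= z] in [R[i]] means that [z] is a nonnegative real; a positive
   functional on a unital C*-algebra has norm [mu 1], so normalization at [1] is
   the norm-one condition. *)
Definition states : set (A -> R[i]) := [set mu |
  [/\ scalar mu, (forall a : A, 0 <= mu (star a * a)) & mu 1 = 1]].

(* The weak-* topology is the topology of pointwise convergence; [convex_set]
   over [R[i]] only involves coefficients in the real interval [0, 1]. *)
Definition closed_convex_hull (K : set (A -> R[i])) : set (A -> R[i]) :=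
  smallest (fun B => closed (B : set {ptws A -> R[i]}) /\
                     @convex_set R[i] (A -> R[i]) B) K.

Definition rieffel (Lip : set A) (L : A -> R) (mu nu : A -> R[i]) : \bar R :=
  ereal_sup [set (Normc.normc (mu a - nu a))%:E | a in [set a | Lip a /\ L a <= 1]].

(* [L] is only meaningful on [Lip]. *)
Record lipschitz_structure := Lipschitz {
  lip_elt : set A ;
  lip_norm : A -> R ;
  lip_dense : dense lip_elt ;
  lip_elt0 : lip_elt 0 ;
  lip_eltP : forall (k : R[i]) a b,
    lip_elt a -> lip_elt b -> lip_elt (k *: a + b) ;
  lip_normZ : forall (k : R[i]) a,
    lip_elt a -> lip_norm (k *: a) = Normc.normc k * lip_norm a ;
  lip_normD : forall a b,
    lip_elt a -> lip_elt b -> lip_norm (a + b) <= lip_norm a + lip_norm b ;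
  lip_norm_eq0 :
    [set a | lip_elt a /\ lip_norm a = 0] = [set k%:A | k in [set: R[i]]] ;
  rieffel_bounded : exists M : R, forall mu nu, states mu -> states nu ->
    (rieffel lip_elt lip_norm mu nu <= M%:E)%E ;
  rieffel_weak_star : forall mu (U : set (A -> R[i])), states mu ->
    within states (nbhs (mu : {ptws A -> R[i]})) U <->
    exists2 e : R, 0 < e & forall nu, states nu ->
      (rieffel lip_elt lip_norm mu nu < e%:E)%E -> U nu
}.

End States.

Arguments states {R} A.

Definition rieffel_dist (R : realType) (A : cstarAlgType R)
    (l : lipschitz_structure A) :=
  rieffel (lip_elt l) (lip_norm l).

Record graph := Graph {
  vertex : finType ;
  edge : finType ;
  rng : edge -> vertex ;
  src : edge -> vertex
}.

Definition no_sinks (G : graph) : Prop :=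
  forall v : vertex G, exists e : edge G, src e = v.

Definition path_space (G : graph) : topologicalType :=
  set_type [set alpha : {ptws nat -> discrete_topology (edge G)} |
    forall i : nat, rng (alpha i : edge G) = src (alpha i.+1 : edge G)].

Record mauldin_williams (R : realType) := MauldinWilliams {
  mw_graph :> graph ;
  mw_alg : vertex mw_graph -> cstarAlgType R ;
  mw_lip : forall v, lipschitz_structure (mw_alg v) ;
  mw_phi : forall e : edge mw_graph, mw_alg (src e) -> mw_alg (rng e) ;
  mw_phi_hom : forall e, star_hom (@mw_phi e) ;
  mw_phi1 : forall e, @mw_phi e 1 = 1 ;
  mw_contr : exists c : R, [/\ 0 < c, c < 1 &
    forall e mu nu, states (mw_alg (rng e)) mu -> states (mw_alg (rng e)) nu ->
      (rieffel_dist (mw_lip (src e)) (mu \o @mw_phi e) (nu \o @mw_phi e)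
        <= c%:E * rieffel_dist (mw_lip (rng e)) mu nu)%E]
}.

Arguments mw_phi {R} m e.

(* [dual_image K v] is the union of the images of the [K (rng e)] under the dual
   maps of the [mw_phi e], over the edges [e] with [src e = v]. *)
Inductive dual_image (R : realType) (M : mauldin_williams R)
    (K : forall v : vertex M, set (mw_alg v -> R[i])) :
    forall v : vertex M, set (mw_alg v -> R[i]) :=
  DualImage (e : edge M) (nu : mw_alg (rng e) -> R[i]) :
    K (rng e) nu -> dual_image K (nu \o mw_phi M e).

Arguments dual_image {R M} K v _.

Definition invariant_family (R : realType) (M : mauldin_williams R)
    (K : forall v : vertex M, set (mw_alg v -> R[i])) : Prop :=
  forall v : vertex M,
    [/\ K v !=set0, K v `<=` states (mw_alg v),
        compact (K v : set {ptws mw_alg v -> R[i]})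
      & K v = dual_image K v].

(* Main.v *)
(* Write phi_w for the composite of the phi_e along the first n edges of a path
   alpha. By contractivity the states mu o phi_w have diameter at most c^n D for
   the Rieffel metric, so they converge to one state x_alpha, and phi_w(a) is
   norm-close to the scalar x_alpha(a). Since phi_w is multiplicative, x_alpha is a
   character of A_v, v = s(alpha_0), and a |-> (alpha |-> x_alpha(a_v)) is a
   *-homomorphism; continuity holds because the convergence is uniform in alpha.
   Invariance of K makes every element of K_v some x_alpha, so an element killed by
   the homomorphism is killed by the closed convex hull of K_v, that is, by all
   states, and is therefore zero.

   That the states of a C*-algebra determine the norm up to a factor 2 is proved
   without spectral theory: square roots come from a fixed point, a^* a >= 0 from a
   quantitative form of the Kelley-Vaught argument, and states from maximal cones. *)

Require Import Defs.
From HB Require Import structures.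
From mathcomp Require Import all_boot all_order all_algebra.
From mathcomp Require Import all_classical all_reals all_analysis.
From mathcomp Require Import complex.
From mathcomp Require Import ring lra.

Set Implicit Arguments.
Unset Strict Implicit.
Unset Printing Implicit Defensive.

Import Order.TTheory GRing.Theory Num.Theory.
Import numFieldNormedType.Exports.

Local Open Scope classical_set_scope.
Local Open Scope ring_scope.
Local Open Scope complex_scope.

(** * Norm and order in a C*-algebra *)

Section RealNorm.
Variables (R : realType) (A : cstarAlgType R).
Implicit Types (a b x y h w : A) (r s t : R).

Definition nrm a : R := complex.Re `|a|.

Lemma nrmE a : `|a| = (nrm a)%:C.
Proof. by rewrite /nrm RRe_real// ger0_real. Qed.

Lemma nrm_ge0 a : 0 <= nrm a.
Proof. by rewrite -ler0c -nrmE. Qed.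

Lemma nrmD a b : nrm (a + b) <= nrm a + nrm b.
Proof. by rewrite -lecR rmorphD/= -!nrmE ler_normD. Qed.

Lemma nrmN a : nrm (- a) = nrm a.
Proof. by rewrite /nrm normrN. Qed.

Lemma nrmB a b : nrm (a - b) <= nrm a + nrm b.
Proof. by rewrite (le_trans (nrmD _ _))// nrmN. Qed.

Lemma nrm_distC a b : nrm (a - b) = nrm (b - a).
Proof. by rewrite -opprB nrmN. Qed.

Lemma nrmM a b : nrm (a * b) <= nrm a * nrm b.
Proof. by rewrite -lecR rmorphM/= -!nrmE; exact: cstar_normM. Qed.

Lemma nrmZ (k : R[i]) a : nrm (k *: a) = Normc.normc k * nrm a.
Proof. by apply: complexI; rewrite rmorphM/= -!nrmE normrZ. Qed.

Lemma nrm_eq0 a : nrm a = 0 -> a = 0.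
Proof. by move=> a0; apply/eqP; rewrite -normr_eq0 nrmE a0. Qed.

Lemma nrm0 : nrm 0 = 0.
Proof. by rewrite /nrm normr0. Qed.

Lemma cstarE a : nrm (star a * a) = nrm a ^+ 2.
Proof.
by apply: complexI; rewrite rmorphXn/= -!nrmE; exact: cstar_identity.
Qed.

Lemma starM a b : star (a * b) = star b * star a.
Proof. exact: cstar_starM. Qed.

Lemma starN a : star (- a) = - star a.
Proof.
by apply/eqP; rewrite -subr_eq0 opprK -starD addNr -[X in star X](scale0r 0) starZ conjc0 scale0r.
Qed.

Lemma starB a b : star (a - b) = star a - star b.
Proof. by rewrite starD starN. Qed.

Lemma star1 : star (1 : A) = 1.
Proof. by rewrite -[LHS]mulr1 -{2}(starK (1 : A)) -starM mulr1 starK. Qed.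

Lemma nrm_star a : nrm (star a) = nrm a.
Proof.
wlog suff : a / nrm a <= nrm (star a).
  by move=> H; apply/le_anti; rewrite H -{2}[a]starK H.
have [->|a0] := eqVneq (nrm a) 0; first exact: nrm_ge0.
rewrite -(@ler_pM2r _ (nrm a)) ?lt_neqAle ?nrm_ge0 ?[0 == _]eq_sym ?a0//.
by rewrite -expr2 -cstarE nrmM.
Qed.

Definition sc r : A := r%:C *: 1.

Lemma sc_is_zmod_morphism : zmod_morphism sc.
Proof. by move=> r s; rewrite /sc rmorphB scalerBl. Qed.

HB.instance Definition _ := GRing.isZmodMorphism.Build R A sc sc_is_zmod_morphism.

Lemma sc_is_monoid_morphism : monoid_morphism sc.
Proof.
by split=> [|r s]; rewrite /sc ?scale1r// rmorphM -scalerA -scalerAl mul1r.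
Qed.

HB.instance Definition _ := GRing.isMonoidMorphism.Build R A sc sc_is_monoid_morphism.

Lemma scE r x : sc r * x = r%:C *: x.
Proof. by rewrite -scalerAl mul1r. Qed.

Lemma scC r x : GRing.comm (sc r) x.
Proof. by rewrite /GRing.comm scE -scalerAr mulr1. Qed.

Lemma star_sc r : star (sc r) = sc r.
Proof. by rewrite starZ star1 conjc_real. Qed.

Lemma nrm_scM r x : nrm (sc r * x) = `|r| * nrm x.
Proof. by rewrite scE nrmZ /= expr0n addr0 sqrtr_sqr. Qed.

Lemma nrm1 : nrm 1 = 1.
Proof.
have := cstarE 1; rewrite star1 mulr1 expr2 => /esym/eqP.
rewrite -[X in _ == X]mulr1 -subr_eq0 -mulrBr mulf_eq0 => /orP[/eqP/nrm_eq0/eqP|].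
  by rewrite oner_eq0.
by rewrite subr_eq0 => /eqP.
Qed.

Lemma nrm_sc r : nrm (sc r) = `|r|.
Proof. by rewrite -[sc r]mulr1 nrm_scM nrm1 mulr1. Qed.

Lemma nrm_sa_sqr h : star h = h -> nrm (h * h) = nrm h ^+ 2.
Proof. by move=> sah; rewrite -{1}sah cstarE. Qed.

End RealNorm.

(** * Square roots by fixed-point iteration *)

Section SquareRoot.
Variables (R : realType) (A : cstarAlgType R).
Implicit Types (a b x y z h w : A) (r s t e : R).

Lemma nrm_le0 x (C : R) : (forall e, 0 < e -> nrm x <= C * e) -> x = 0.
Proof.
move=> H; apply: nrm_eq0; apply/le_anti; rewrite nrm_ge0 andbT.
apply/ler_addgt0Pr => e e0; rewrite add0r.
have d0 : 0 < `|C| + 1 by rewrite ltr_wpDl.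
apply: (le_trans (H (e / (`|C| + 1)) _)); first by rewrite divr_gt0.
by rewrite mulrCA ler_piMr ?ltW// ltr_pdivrMr// mul1r ltr_pwDr// ler_norm.
Qed.

Lemma nrm_complete (u : nat -> A) (q : R) : 0 <= q < 1 ->
  (forall n k, nrm (u (n + k)%N - u n) <= q ^+ n) ->
  exists l, forall e, 0 < e -> exists N, forall n, (N <= n)%N -> nrm (l - u n) <= e.
Proof.
move=> /andP[q0 q1] uq.
have qlim e : 0 < e -> exists N, q ^+ N < e.
  move=> e0; have := @cvg_expr R q; rewrite ger0_norm// => /(_ q1).
  move=> /cvgrPdist_lt /(_ e e0)[N _ /(_ N (leqnn N))].
  by rewrite sub0r normrN ger0_norm ?exprn_ge0// => ?; exists N.
have : cauchy (u n @[n --> \oo]).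
  apply/cauchy_exP => e; rewrite ltcE/= => /andP[/eqP e0 e1].
  have [N qN] := qlim _ e1; exists (u N); exists N => // n /= Nn.
  rewrite -ball_normE/= distrC nrmE ltcE/= e0 eqxx/=.
  by rewrite (le_lt_trans _ qN)// -(subnKC Nn).
move=> /cauchy_cvgP/cvg_ex[l /cvgrPdist_le ul]; exists l => e e0.
have /ul[N _ H] : 0 < e%:C by rewrite ltcR.
by exists N => n /H; rewrite nrmE lecR.
Qed.

(* [1 - w] is the fixed point of the contraction [y |-> (x + y ^ 2) / 2]. *)
Lemma sqrt_1B x : star x = x -> nrm x < 1 ->
  exists w, [/\ star w = w, nrm (1 - w) <= nrm x,
    (forall z, GRing.comm z x -> GRing.comm z w) & w * w = 1 - x].
Proof.
move=> sax x1; set q := nrm x in x1 *.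
have q0 : 0 <= q by exact: nrm_ge0.
pose f y := sc A 2^-1 * (x + y * y); pose u n := iter n f 0.
have nhalf y : nrm (sc A 2^-1 * y) = nrm y / 2.
  by rewrite nrm_scM ger0_norm ?invr_ge0// mulrC.
have uq n : nrm (u n) <= q.
  elim: n => [|n IH]; first by rewrite nrm0.
  rewrite /= nhalf ler_pdivrMr// mulr_natr mulr2n (le_trans (nrmD _ _))// lerD//.
  rewrite (le_trans (nrmM _ _))// -[leRHS]mulr1 ler_pM ?nrm_ge0//.
  by rewrite (le_trans IH)// ltW.
have flip y z : nrm y <= q -> nrm z <= q -> nrm (f y - f z) <= q * nrm (y - z).
  move=> yq zq; rewrite -mulrBr nhalf ler_pdivrMr//.
  have -> : x + y * y - (x + z * z) = y * (y - z) + (y - z) * z.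
    by rewrite mulrBr mulrBl addrA subrK opprD addrACA subrr add0r.
  rewrite (le_trans (nrmD _ _))// mulr_natr mulr2n lerD//.
    by rewrite (le_trans (nrmM _ _))// ler_wpM2r// nrm_ge0.
  by rewrite (le_trans (nrmM _ _))// mulrC ler_wpM2r// nrm_ge0.
(* The base case is [|u k| <= q < 1]; each further iterate gains a factor [q] from [flip]. *)
have ucauchy n k : nrm (u (n + k)%N - u n) <= q ^+ n.
  elim: n => [|n IH].
    by rewrite add0n subr0 expr0 (le_trans (uq _))// ltW.
  rewrite addSn /= exprS; apply: (le_trans (flip _ _ _ _)) => //.
  by rewrite ler_wpM2l.
have [|l ul] := nrm_complete _ ucauchy; first by rewrite q0.
have lq : nrm l <= q.
  apply/ler_addgt0Pr => e /ul[N /(_ N (leqnn N)) lN].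
  by rewrite -[l](subrK (u N)) addrC (le_trans (nrmD _ _))// lerD.
have star_u n : star (u n) = u n.
  elim: n => [|n IH]; first by rewrite /= -{1}(scale0r 0) starZ conjc0 scale0r.
  by rewrite /= /f starM star_sc starD starM IH sax scC.
have comm_u z n : GRing.comm z x -> GRing.comm z (u n).
  move=> zx; elim: n => [|n IH]; first exact: commr0.
  by apply: commrM; [exact/commr_sym/scC | apply: commrD => //; exact: commrM].
have fl : f l = l.
  apply/eqP; rewrite -subr_eq0; apply/eqP/(@nrm_le0 _ 2) => e /ul[N uN].
  rewrite -(subrK (f (u N)) (f l)) -addrA (le_trans (nrmD _ _))// mulr_natl mulr2n lerD//.
    rewrite (le_trans (flip _ _ _ _))//.
    rewrite (le_trans _ (uN _ (leqnn N)))// ler_piMl ?nrm_ge0//; exact: ltW.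
  by rewrite nrm_distC (uN N.+1).
exists (1 - l); split.
- rewrite starB star1; congr (_ - _).
  apply/eqP; rewrite -subr_eq0; apply/eqP/(@nrm_le0 _ 2) => e /ul[N /(_ N (leqnn N)) uN].
  rewrite -(subrK (star (u N)) (star l)) -addrA (le_trans (nrmD _ _))//.
  rewrite mulr_natl mulr2n lerD//; first by rewrite -starB nrm_star.
  by rewrite star_u nrm_distC.
- by rewrite subKr.
- move=> z zx; apply: commrB; first exact: commr1.
  apply/eqP; rewrite -subr_eq0; apply/eqP/(@nrm_le0 _ (2 * nrm z)) => e /ul[N /(_ N (leqnn N)) uN].
  have -> : z * l - l * z = z * (l - u N) - (l - u N) * z.
    by rewrite mulrBr mulrBl comm_u// opprB addrA subrK.
  rewrite (le_trans (nrmB _ _))// -mulrA mulr_natl mulr2n lerD//.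
    by rewrite (le_trans (nrmM _ _))// ler_wpM2l// nrm_ge0.
  by rewrite (le_trans (nrmM _ _))// mulrC ler_wpM2l// nrm_ge0.
(* Doubling [f l = l] gives [x + l ^ 2 = 2 l], that is [(1 - l) ^ 2 = 1 - x]. *)
- have : sc A 2 * f l = sc A 2 * l by rewrite fl.
  rewrite /f mulrA -rmorphM mulfV// rmorph1 mul1r (rmorphMn _ 2%N 1) rmorph1 mulr_natl mulr2n => E.
  have -> : x = l + l - l * l by rewrite -E addrK.
  by rewrite mulrBr mulr1 mulrBl mul1r -addrA -opprD addrA.
Qed.

End SquareRoot.

(** * Positive elements described by the norm *)

Section Positive.
Variables (R : realType) (A : cstarAlgType R).
Implicit Types (a b x y z h w : A) (r s t e k : R).
Local Notation sc := (sc A).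

(* [u = h + i w] satisfies [u^* u = k], and [2 i w = u - u^*]. *)
Lemma circle_nrm_le h w k : star h = h -> star w = w -> GRing.comm h w ->
  h * h + w * w = sc k -> nrm w ^+ 2 <= `|k|.
Proof.
move=> sah saw hw hwk; pose u := h + 'i%C *: w.
have su : star u = h - 'i%C *: w.
  by rewrite starD starZ sah saw -scaleNr; congr (_ + _ *: _); simpc.
have u2 : star u * u = sc k.
  rewrite su -hwk mulrBl !mulrDr -!scalerAl -!scalerAr hw opprD addrACA.
  by rewrite addrA subrK scalerA -[_ * 'i%C]expr2 sqr_i scaleN1r opprK.
have : nrm (star u * u) = `|k| by rewrite u2 nrm_sc.
rewrite cstarE => <-; rewrite ler_sqr ?nnegrE ?nrm_ge0//.
have : nrm (u - star u) <= nrm u * 2.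
  by rewrite (le_trans (nrmB _ _))// nrm_star mulr_natr mulr2n.
rewrite su opprB addrC subrKA -scalerDl nrmZ -[_ + _]/(Complex _ _)/=.
by rewrite addr0 expr0n add0r sqrtr_sqr ger0_norm ?addr_ge0// mulrC ler_pM2r.
Qed.

(* Positivity without spectra: a self-adjoint [x] has its spectrum in
   [0, +oo) iff [|t - x| <= t] for some, equivalently for every large, [t]. *)
Definition pos x := star x = x /\ exists t, nrm (sc t - x) <= t.

Lemma pos_sa x : pos x -> star x = x. Proof. by case. Qed.

Lemma posD x y : pos x -> pos y -> pos (x + y).
Proof.
move=> [sx [s xs]] [sy [t yt]]; split; first by rewrite starD sx sy.
exists (s + t); rewrite rmorphD/= opprD addrACA.
by rewrite (le_trans (nrmD _ _))// lerD.
Qed.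

Lemma pos_scM r x : 0 <= r -> pos x -> pos (sc r * x).
Proof.
move=> r0 [sx [s xs]]; split; first by rewrite starM star_sc sx scC.
by exists (r * s); rewrite rmorphM/= -mulrBr nrm_scM ger0_norm// ler_wpM2l.
Qed.

Lemma pos_sc r : 0 <= r -> pos (sc r).
Proof.
by move=> r0; split; [exact: star_sc | exists r; rewrite subrr nrm0].
Qed.

Lemma pos_nrmB x k : star x = x -> nrm x <= k -> pos (sc k - x).
Proof.
move=> sx xk; split; first by rewrite starB star_sc sx.
by exists k; rewrite subKr.
Qed.

Lemma pos_nrmD x k : star x = x -> nrm x <= k -> pos (sc k + x).
Proof.
by move=> sx xk; rewrite -[x]opprK; apply: pos_nrmB; rewrite ?starN ?sx ?nrmN.
Qed.

(** Rescaling [sqrt_1B] gives [w] commuting with [h] such that [w ^ 2 = S - h ^ 2]; then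
    [h ^ 2 + w ^ 2 = S], and [circle_nrm_le] bounds [|w| ^ 2]. *)
Lemma sqr_dist h S : star h = h -> nrm h ^+ 2 < S -> nrm (sc S - h * h) <= S.
Proof.
move=> sah hS; have S0 : 0 < S by rewrite (le_lt_trans _ hS)// sqr_ge0.
pose x := sc S^-1 * (h * h).
have [||w0 [saw0 _ cw0 w0E]] := @sqrt_1B _ _ x.
- by rewrite /x starM star_sc starM sah scC.
- by rewrite nrm_scM gtr0_norm ?invr_gt0// nrm_sa_sqr// mulrC ltr_pdivrMr// mul1r.
pose w := sc (Num.sqrt S) * w0.
have ww : w * w = sc S - h * h.
  rewrite /w -mulrA (mulrA w0) -(scC _ w0) !mulrA -rmorphM -expr2 sqr_sqrtr ?ltW//.
  by rewrite -mulrA w0E mulrBr mulr1 mulrA -rmorphM mulfV ?gt_eqF// rmorph1 mul1r.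
have saw : star w = w by rewrite /w starM star_sc saw0 scC.
rewrite -ww nrm_sa_sqr// -[leRHS](ger0_norm (ltW S0)).
apply: (@circle_nrm_le h w S) => //; last by rewrite ww addrC subrK.
apply: commrM; first exact/commr_sym/scC.
by apply: cw0; apply: commrM; [exact/commr_sym/scC | exact: commrM].
Qed.

Lemma pos_sqr h : star h = h -> pos (h * h).
Proof.
move=> sah; split; first by rewrite starM sah.
by exists (nrm h ^+ 2 + 1); apply: sqr_dist => //; rewrite ltrDl.
Qed.

(** If [t] witnesses [pos x], the shift by [e] makes the norm of [z = (t - x) / (t + e)] less than
    1, and [x + e = (t + e) (1 - z)], so [sqrt_1B] applies. *)
Lemma pos_sqrt x e : pos x -> 0 < e -> exists w,
  [/\ pos w, (forall z, GRing.comm z x -> GRing.comm z w) & w * w = x + sc e].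
Proof.
move=> [sx [t xt]] e0; have t0 : 0 <= t by rewrite (le_trans _ xt)// nrm_ge0.
pose T := t + e; have T0 : 0 < T by rewrite ltr_wpDl.
pose z := sc T^-1 * (sc t - x).
have z1 : nrm z < 1.
  rewrite nrm_scM gtr0_norm ?invr_gt0// mulrC ltr_pdivrMr// mul1r.
  by rewrite (le_lt_trans xt)// ltrDl.
have [|//|w0 [saw0 w01 cw0 w0E]] := @sqrt_1B _ _ z.
  by rewrite /z starM star_sc starB star_sc sx scC.
exists (sc (Num.sqrt T) * w0); split.
- apply: pos_scM; first exact: sqrtr_ge0.
  by split=> //; exists 1; rewrite rmorph1 (le_trans w01)// ltW.
- move=> y yx; apply: commrM; first exact/commr_sym/scC.
  apply: cw0; apply: commrM; first exact/commr_sym/scC.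
  by apply: commrB => //; exact/commr_sym/scC.
- rewrite -mulrA (mulrA w0) -(scC _ w0) !mulrA -rmorphM -expr2 sqr_sqrtr ?ltW//.
  rewrite -mulrA w0E mulrBr mulr1 mulrA -rmorphM mulfV ?gt_eqF// rmorph1 mul1r.
  by rewrite opprB addrCA -rmorphB/= /T addrAC subrr add0r.
Qed.

(** Up to a small scalar, [x] is a square [w ^ 2], to which [sqr_dist] applies. Hence every [s]
    above the norm is a witness of positivity. *)
Lemma pos_dist x s : pos x -> nrm x <= s -> nrm (sc s - x) <= s.
Proof.
move=> px xs; apply/ler_addgt0Pr => e e0.
have e30 : 0 < e / 3 by rewrite divr_gt0.
have [w [pw _ ww]] := pos_sqrt px e30.
have /(sqr_dist (pos_sa pw)) : nrm w ^+ 2 < s + e / 3 *+ 2.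
  rewrite -nrm_sa_sqr ?(pos_sa pw)// ww (le_lt_trans (nrmD _ _))//.
  by rewrite nrm_sc gtr0_norm// mulr2n addrA ltr_pwDr// lerD2r.
rewrite ww => H.
have -> : sc s - x = (sc (s + e / 3 *+ 2) - (x + sc (e / 3))) - sc (e / 3).
  by rewrite mulr2n addrA 2!rmorphD/= (addrC x) opprD addrA addrK addrAC addrK.
rewrite (le_trans (nrmB _ _))// (le_trans (lerD H (lexx _)))//.
by rewrite nrm_sc gtr0_norm//; lra.
Qed.

(** By [pos_dist] the witness for [x + e] can be taken to be [|x| + e], and these bounds pass to the
    limit. *)
Lemma pos_closed x : (forall e, 0 < e -> pos (x + sc e)) -> pos x.
Proof.
move=> H; have sx : star x = x.
  by have := pos_sa (H 1 ltr01); rewrite starD star_sc => /addIr.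
split=> //; exists (nrm x); apply/ler_addgt0Pr => e e0.
have : nrm (x + sc e) <= nrm x + e.
  by rewrite (le_trans (nrmD _ _))// nrm_sc gtr0_norm.
by move=> /(pos_dist (H _ e0)); rewrite rmorphD/= opprD addrACA subrr addr0.
Qed.

(** Commuting roots [w] of [k - x + e] and [v] of [k + x + e] satisfy
    [(w v) ^ 2 + x ^ 2 = (k + e) ^ 2], so [circle_nrm_le] bounds [|x|]. *)
Lemma pos_nrm_le x k : pos (sc k - x) -> pos (sc k + x) -> nrm x <= k.
Proof.
move=> pB pD; have k0 : 0 <= k.
  have [_ [t]] := posD pB pD.
  rewrite addrACA addNr addr0 -rmorphD -rmorphB/= nrm_sc.
  move=> H; have := le_trans (ler_norm _) H; lra.
have sx : star x = x.
  by have := pos_sa pD; rewrite starD star_sc => /addrI.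
apply/ler_addgt0Pr => e e0.
have [w [pw cw ww]] := pos_sqrt pB e0; have [v [pv cv vv]] := pos_sqrt pD e0.
have xw : GRing.comm x w.
  by apply: cw; apply: commrB => //; exact/commr_sym/scC.
have xv : GRing.comm x v.
  by apply: cv; apply: commrD => //; exact/commr_sym/scC.
have wv : GRing.comm w v.
  by apply: cv; apply: commrD; [exact/commr_sym/scC | exact/commr_sym].
have E : w * v * (w * v) + x * x = sc ((k + e) ^+ 2).
  rewrite -mulrA (mulrA v) -wv -mulrA vv mulrA ww.
  have -> : sc k - x + sc e = sc (k + e) - x by rewrite addrAC -rmorphD.
  have -> : sc k + x + sc e = sc (k + e) + x by rewrite addrAC -rmorphD.
  by rewrite mulrDr mulrBl mulrBl -rmorphM/= -expr2 addrA scC subrK subrK.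
have ke : 0 <= k + e by rewrite addr_ge0// ltW.
have swv : star (w * v) = w * v by rewrite starM (pos_sa pw) (pos_sa pv) wv.
have := circle_nrm_le swv sx (commr_sym (commrM xw xv)) E.
by rewrite ger0_norm ?sqr_ge0// ler_sqr ?nnegrE ?nrm_ge0.
Qed.

(** The roots of [x + d] and [y + d] commute, and their product squares to
    [x y + d (x + y) + d ^ 2]; [d] is chosen so that the error has norm at most [e]. *)
Lemma posM x y : GRing.comm x y -> pos x -> pos y -> pos (x * y).
Proof.
move=> xy px py; have sx := pos_sa px; have sy := pos_sa py.
apply: pos_closed => e e0.
pose N := nrm x + nrm y + 1.
have N1 : 0 < N by rewrite ltr_wpDl ?addr_ge0 ?nrm_ge0.
pose d := Num.min 1 (e / N).
have d0 : 0 < d by rewrite lt_min ltr01 divr_gt0.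
have dN : d * (nrm x + nrm y) + d ^+ 2 <= e.
  have d1 : d <= 1 by rewrite ge_min lexx.
  have : d * N <= e by rewrite -ler_pdivlMr// ge_min lexx orbT.
  have : d ^+ 2 <= d by rewrite expr2 ler_piMl// ltW.
  by rewrite /N mulrDr mulr1; lra.
have [w [pw cw ww]] := pos_sqrt px d0; have [v [pv cv vv]] := pos_sqrt py d0.
have yw : GRing.comm y w by apply: cw; exact: commr_sym.
have wv : GRing.comm w v by apply: cv; exact: commr_sym.
have swv : star (w * v) = w * v by rewrite starM (pos_sa pw) (pos_sa pv) wv.
have E : w * v * (w * v) = x * y + sc d * (x + y) + sc (d ^+ 2).
  rewrite -mulrA (mulrA v) -wv -mulrA vv mulrA ww.
  by rewrite mulrDr !mulrDl -rmorphM -expr2 mulrDr -(scC d x) !addrA (addrAC (x * y)).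
have -> : x * y + sc e = w * v * (w * v) +
    (sc (e - d ^+ 2) - sc d * (x + y)).
  by rewrite E rmorphB/= -!addrA; congr (_ + _); rewrite (addrCA (sc (d ^+ 2))) addNKr addrC subrK.
apply: posD; first exact: pos_sqr.
apply: pos_nrmB; first by rewrite starM star_sc starD sx sy scC.
rewrite nrm_scM gtr0_norm// lerBrDr (le_trans _ dN)// lerD2r ler_pM2l//.
exact: nrmD.
Qed.

End Positive.

(** * Positivity of [a^* a] *)

Section StarSquare.
Variables (R : realType) (A : cstarAlgType R).
Implicit Types (a b x y z h w : A) (r s t e k : R).
Local Notation sc := (sc A).

Lemma star_sqr_sa a : star (star a * a) = star a * a.
Proof. by rewrite starM starK. Qed.

Lemma star_skew_part a :
  star ('i%C *: (a - star a)) = 'i%C *: (a - star a).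
Proof.
by rewrite starZ starB starK -opprB scalerN -scaleNr; congr (_ *: _); simpc.
Qed.

(** The sum is half of [X ^ 2 + Y ^ 2], where [X] and [Y] are twice the real and, up to sign, the
    imaginary part of [a]. *)
Lemma pos_mulstar_add a : pos (a * star a + star a * a).
Proof.
pose X := a + star a; pose Y := 'i%C *: (a - star a).
have sX : star X = X by rewrite /X starD starK addrC.
have sY : star Y = Y.
  exact: star_skew_part.
have -> : a * star a + star a * a = sc 2^-1 * (X * X + Y * Y).
  have -> : Y * Y = - ((a - star a) * (a - star a)).
    by rewrite -scalerAl -scalerAr scalerA -[_ * 'i%C]expr2 sqr_i scaleN1r.
  have -> : X * X - (a - star a) * (a - star a) = (a * star a + star a * a) *+ 2.
    rewrite /X !mulrDl !mulrDr !(mulNr, mulrN) !opprD !opprK mulr2n !addrA.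
    by rewrite [LHS](ACl ((1*5)*(4*8)*2*3*6*7))/= !subrr !add0r.
  by rewrite -[(a * _ + _) *+ 2]mulr_natl -(rmorph_nat sc 2) mulrA -rmorphM mulVf// rmorph1 mul1r.
by apply: pos_scM; rewrite ?invr_ge0//; apply: posD; exact: pos_sqr.
Qed.

(* With [f = a^* a] and [s = |f|], the bound comes from comparing
   [s f - f ^ 2 = a^* (s - a a^* ) a], which is at least [- s (s + k)], with the
   positive element [(s + f) (k - f)]. *)
Lemma nrm_sqr_le a k : 0 <= k -> pos (sc k - star a * a) -> nrm a ^+ 2 <= 3 * k.
Proof.
move=> k0 H; set f := star a * a in H; pose d := a * star a; pose s := nrm a ^+ 2.
have sf : star f = f by exact: star_sqr_sa.
have sd : star d = d by rewrite /d starM starK.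
have nf : nrm f = s by exact: cstarE.
have nd : nrm d = s by rewrite /d -{1}[a]starK cstarE nrm_star.
have s0 : 0 <= s by exact: sqr_ge0.
(* [k + d] is the sum of [k - f] and [d + f]. *)
have pd : pos (sc k + d).
  by rewrite -(subrK f (sc k)) -addrA (addrC f); apply: posD => //; exact: pos_mulstar_add.
have psd : pos (sc s - d) by apply: pos_nrmB; rewrite ?nd.
have nsd : nrm (sc s - d) <= s + k.
  apply: pos_nrm_le.
    by rewrite rmorphD/= opprB addrC addrA subrK addrC.
  by rewrite addrC; apply: posD => //; apply: pos_sc; exact: addr_ge0.
pose W := sc s * f - f * f.
have WE : W = star a * (sc s - d) * a.
  by rewrite mulrBr mulrBl -(scC s (star a)) /W /d /f !mulrA.
have nW : nrm W <= s * (s + k).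
  rewrite WE (le_trans (nrmM _ _))// (le_trans (ler_wpM2r (nrm_ge0 _) (nrmM _ _)))//.
  by rewrite nrm_star mulrAC -expr2 ler_wpM2l.
have sW : star W = W.
  by rewrite /W starB (starM (sc s)) (starM f) star_sc sf scC.
have : nrm (sc 2 * (f * f)) <= s * (s + k) + (s * k) *+ 2.
  apply: pos_nrm_le; last first.
    apply: posD; last by apply: pos_scM => //; exact: pos_sqr.
    by apply: pos_sc; rewrite addr_ge0// ?mulrn_wge0// mulr_ge0// addr_ge0.
  have -> : sc (s * (s + k) + (s * k) *+ 2) - sc 2 * (f * f) =
      (sc (s * (s + k)) + W) + (sc s + f) * (sc k - f) + sc k * (sc s - f).
    rewrite /W mulrDl !mulrBr -(scC k f) -!rmorphM (mulrC k s) (rmorph_nat sc 2) mulr_natl !mulr2n !rmorphD/= !addrA.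
    rewrite [RHS](ACl (1*4*8*(2*5)*(6*9)*(3*7)))/=.
    by rewrite !subrr !addr0 -opprD.
  apply: posD; first apply: posD.
  - exact: pos_nrmD.
  - apply: posM => //; last by apply: pos_nrmD; rewrite ?nf.
    apply: commrB; first exact/commr_sym/scC.
    by apply/commr_sym/commrD => //; exact/commr_sym/scC.
  - by apply: pos_scM => //; apply: pos_nrmB; rewrite ?nf.
(* The bound reads [2 s ^ 2 <= s (s + k) + 2 s k], that is [s ^ 2 <= 3 s k]. *)
rewrite nrm_scM nrm_sa_sqr// nf ger0_norm// => H2.
rewrite -/s; have [->|sn0] := eqVneq s 0; first by rewrite mulr_ge0.
rewrite -(@ler_pM2l _ s) ?lt_neqAle ?s0 ?[0 == _]eq_sym ?sn0//.
by move: H2; rewrite mulr2n mulrDr expr2; lra.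
Qed.

(* [g = sqrt (b ^ 2 + d ^ 2) - b] approximates twice the negative part of
   [b = a^* a]. As [(a g)^* (a g) = g b g] is bounded above by [d ^ 2 |g|], the
   previous estimate makes [g] small. *)
Lemma pos_star_sqr a : pos (star a * a).
Proof.
set b := star a * a; have sb : star b = b by exact: star_sqr_sa.
apply: pos_closed => e e0; pose d := e / 3.
have d0 : 0 < d by rewrite divr_gt0.
have d20 : 0 < d ^+ 2 by rewrite exprn_gt0.
have [r [pr cr rr]] := pos_sqrt (pos_sqr sb) d20.
have br : GRing.comm b r by apply: cr; exact: commrM.
have sr := pos_sa pr.
have [g gE] : {g | g = r - b} by exists (r - b).
have sg : star g = g by rewrite gE starB sr sb.
have gr : GRing.comm g r by rewrite gE; apply/commr_sym/commrB => //; exact/commr_sym.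
have gb : GRing.comm g b by rewrite gE; apply/commr_sym/commrB.
have rbg : (r + b) * g = sc (d ^+ 2).
  by rewrite gE mulrDl !mulrBr rr br addrA subrK addrC addKr.
have gbg : g * b * g = sc (d ^+ 2) * g - g * r * g.
  by rewrite -rbg !mulrDl -gr -gb addrAC subrr add0r.
suff ng : nrm g <= 3 * d.
  have -> : b + sc e = r + (sc e - g) by rewrite gE opprB addrCA [r + _]addrC subrK addrC.
  apply: posD => //; apply: pos_nrmB => //.
  by rewrite (le_trans ng)// /d mulrC divfK.
have gg : star (a * g) * (a * g) = g * b * g by rewrite starM sg /b !mulrA.
have k0 : 0 <= d ^+ 2 * nrm g by rewrite mulr_ge0 ?nrm_ge0// ltW.
have nag : nrm (a * g) ^+ 2 <= 3 * (d ^+ 2 * nrm g).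
  apply: nrm_sqr_le => //.
  have -> : sc (d ^+ 2 * nrm g) - star (a * g) * (a * g) =
      sc (d ^+ 2) * (sc (nrm g) - g) + g * g * r.
    have -> : g * g * r = g * r * g by rewrite -!mulrA -gr.
    by rewrite gg gbg rmorphM/= mulrBr opprB addrA [RHS]addrAC.
  apply: posD; first by apply: pos_scM; [exact: ltW | exact: pos_nrmB].
  by apply: posM => //; [exact/commr_sym/commrM; exact/commr_sym | exact: pos_sqr].
(* Since [g = r - b], also [g ^ 3 = g r g - g b g]; this eliminates [r] from [gbg]. *)
have gbg2 : g * b * g *+ 2 = sc (d ^+ 2) * g - g * g * g.
  have -> : g * g * g = g * r * g - g * b * g by rewrite {2}gE mulrBr mulrBl.
  by rewrite opprB addrCA -gbg mulr2n.
set n := nrm g in k0 nag *.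
have n0 : 0 <= n by exact: nrm_ge0.
have g3 : nrm (g * g * g) <= 7 * (d ^+ 2 * n).
  have -> : g * g * g = sc (d ^+ 2) * g - g * b * g *+ 2 by rewrite gbg2 subKr.
  rewrite (le_trans (nrmB _ _))// nrm_scM gtr0_norm// mulr2n.
  have := nrmD (g * b * g) (g * b * g).
  by move: nag; rewrite -cstarE gg -/n; lra.
have n4 : (n ^+ 2) ^+ 2 <= 7 * d ^+ 2 * n ^+ 2.
  rewrite -(nrm_sa_sqr sg) -(nrm_sa_sqr (pos_sa (pos_sqr sg))) (nrm_sa_sqr sg) mulrA.
  by rewrite (le_trans (nrmM _ _))// (le_trans (ler_wpM2r n0 g3))// -/n; lra.
(* [n ^ 4 <= 7 d ^ 2 n ^ 2] forces [n ^ 2 <= 7 d ^ 2], against [n > 3 d]. *)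
rewrite leNgt; apply/negP => nd; have n1 : 0 < n by rewrite (le_lt_trans _ nd)// mulr_ge0// ltW.
move: n4; rewrite [X in X <= _]expr2 ler_pM2r ?exprn_gt0// leNgt => /negP; apply.
have : (3 * d) ^+ 2 < n ^+ 2 by rewrite ltr_sqr ?nnegrE// mulr_ge0// ltW.
by rewrite exprMn; lra.
Qed.

End StarSquare.

(** * Existence of states *)

Section Separation.
Variables (R : realType) (A : cstarAlgType R).
Implicit Types (a b x y z : A) (r s t e : R) (C : set A).
Local Notation sc := (sc A).

Definition convex_cone C :=
  (forall x y, C x -> C y -> C (x + y)) /\
  (forall r x, 0 <= r -> C x -> C (sc r * x)).

(* This cone contains every skew-adjoint element, so that a functional that is
   nonnegative on it vanishes there. *)
Definition accretive : set A := [set x | pos (x + star x)].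

Lemma accretive_cone : convex_cone accretive.
Proof.
split=> [x y px py|r x r0 px]; rewrite /accretive/=.
  by rewrite starD addrACA; exact: posD.
by rewrite starM star_sc -(scC _ (star x)) -mulrDr; exact: pos_scM.
Qed.

Lemma accretive_sa x : star x = x -> accretive x <-> pos x.
Proof.
move=> sx; rewrite /accretive/= sx; split=> [px|px]; last exact: posD.
have -> : x = sc 2^-1 * (x + x).
  by rewrite -mulr2n -[x *+ 2]mulr_natl -(rmorph_nat sc 2) mulrA -rmorphM mulVf// rmorph1 mul1r.
by apply: pos_scM => //; rewrite invr_ge0.
Qed.

Lemma accretive_sc r : 0 <= r -> accretive (sc r).
Proof. by move=> r0; apply/accretive_sa; [exact: star_sc | exact: pos_sc]. Qed.

Lemma accretive_nrmD x : accretive (sc (nrm x) + x).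
Proof.
rewrite /accretive/= starD star_sc addrACA -rmorphD/=; apply: pos_nrmD.
  by rewrite starD starK addrC.
by rewrite (le_trans (nrmD _ _))// nrm_star.
Qed.

Definition separating_cone (h : A) C :=
  [/\ convex_cone C, accretive `<=` C & ~ C h].

(* A cone that is maximal among those missing [h] is total: if it contained
   neither [x] nor [- x], then [h] would be in both extensions, hence in the cone. *)
Lemma total_cone_exists h : star h = h -> ~ pos h ->
  exists C, separating_cone h C /\ forall x, C x \/ C (- x).
Proof.
move=> sh nph.
(* Taking the union with [accretive] inside the predicate also covers the empty chain, whose union
   is empty. *)
have [|M [good maxM]] :=
    @Zorn_bigcup A [set X | separating_cone h (X `|` accretive)].
  move=> F FP Ftot; set U := \bigcup_(X in F) X.
  have UX X : F X -> X `|` accretive `<=` U `|` accretive.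
    by move=> FX; apply: setSU; exact: bigcup_sup.
  split; last 2 first.
  - by move=> x; right.
  - move=> [[X FX Xh]|/accretive_sa]; last by move=> /(_ sh).
    by have [_ _] := FP _ FX; apply; left.
  - split=> [x y|r x r0].
      move=> [[X FX Xx]|px] [[Y FY Yy]|py].
      + have [XY|YX] := Ftot _ _ FX FY.
          by apply: (UX _ FY); have [[+ _] _ _] := FP _ FY; apply; left => //; exact: XY.
        by apply: (UX _ FX); have [[+ _] _ _] := FP _ FX; apply; left => //; exact: YX.
      + by apply: (UX _ FX); have [[+ _] _ _] := FP _ FX; apply; [left | right].
      + by apply: (UX _ FY); have [[+ _] _ _] := FP _ FY; apply; [right | left].
      + by right; apply: accretive_cone.1.
    move=> [[X FX Xx]|px]; last by right; apply: accretive_cone.2.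
    by apply: (UX _ FX); have [[_ +] _ _] := FP _ FX; apply => //; left.
set C := M `|` accretive in good.
have maxC D : separating_cone h D -> C `<=` D -> D `<=` C.
  move=> Dgood CD; apply: contrapT => nDC; apply: (maxM D).
    split; first by move=> x Mx; apply: CD; left.
    by move=> DM; apply: nDC => x /DM; left.
  by rewrite /= (_ : D `|` accretive = D)//; apply/setUidPl; case: Dgood.
case: good => -[CD CZ] accC nCh.
exists C; split=> // x; apply: contrapT => /not_orP[nCx nCNx].
have ext y : ~ C y -> exists c r, [/\ C c, 0 <= r & h = c + sc r * y].
  move=> nCy; apply: contrapT => nh; apply: nCy.
  pose D := [set z | exists c r, [/\ C c, 0 <= r & z = c + sc r * y]].
  have C0 : C 0 by apply: accC; rewrite -(rmorph0 sc); exact: accretive_sc.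
  apply: (maxC D); last by exists 0, 1; split=> //; rewrite rmorph1 mul1r add0r.
    split=> //; last by move=> z /accC Cz; exists z, 0; split=> //; rewrite rmorph0 mul0r addr0.
    split=> [_ _ [c [r [Cc r0 ->]]] [d [s [Cd s0 ->]]]|s _ s0 [c [r [Cc r0 ->]]]].
      exists (c + d), (r + s); split; [exact: CD | exact: addr_ge0 |].
      by rewrite rmorphD/= mulrDl addrACA.
    exists (sc s * c), (s * r); split; [exact: CZ | exact: mulr_ge0 |].
    by rewrite mulrDr rmorphM/= mulrA.
  by move=> z Cz; exists z, 0; split=> //; rewrite rmorph0 mul0r addr0.
have [c [r [Cc r0 hc]]] := ext _ nCx; have [d [s [Cd s0 hd]]] := ext _ nCNx.
have rs0 : 0 < r + s.
  rewrite lt_neqAle addr_ge0// andbT eq_sym; apply/eqP => rs; apply: nCh.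
  have r00 : r = 0 by lra.
  by rewrite hc r00 rmorph0 mul0r addr0.
(* The multiples of [x] and [- x] cancel in this combination, leaving [(r + s) h]. *)
have : C (sc s * c + sc r * d) by apply: CD; exact: CZ.
have -> : sc s * c + sc r * d = sc (r + s) * h.
  have -> : c = h - sc r * x by rewrite hc addrK.
  have -> : d = h + sc s * x by rewrite hd mulrN subrK.
  rewrite mulrBr mulrDr !mulrA -!rmorphM/= (mulrC s) addrCA subrK.
  by rewrite -mulrDl -rmorphD.
move=> /(CZ (r + s)^-1); rewrite invr_ge0 ltW// => /(_ isT).
by rewrite mulrA -rmorphM mulVf ?gt_eqF// rmorph1 mul1r.
Qed.

(** Each [x] is sent to the real [t] at which [x - t] leaves a total cone [C] missing [h].
    Uniqueness of this cut gives linearity, and [- h] in [C] gives the sign at [h]. *)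
Lemma separating_functional h : star h = h -> ~ pos h -> exists f : A -> R,
  [/\ forall x y, f (x + y) = f x + f y, forall r x, f (sc r * x) = r * f x,
      forall x, accretive x -> 0 <= f x, f 1 = 1 & f h <= 0].
Proof.
move=> sh nph; have [C [[[CD CZ] accC nCh] Ctot]] := total_cone_exists sh nph.
(* A negative scalar in [C], scaled to [- |h|] and added to [|h| + h], would put [h] in [C]. *)
have Csc r : C (sc r) -> 0 <= r.
  move=> Cr; rewrite leNgt; apply/negP => r0; apply: nCh.
  have -> : h = (sc (nrm h) + h) + sc (nrm h / - r) * sc r.
    by rewrite -rmorphM invrN mulrN mulNr divfK ?lt_eqF// rmorphN/= addrAC subrr add0r.
  apply: CD; first exact/accC/accretive_nrmD.
  by apply: CZ => //; rewrite divr_ge0 ?nrm_ge0// oppr_ge0 ltW.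
(* Nothing is asked at the cut [v] itself, because [C] need not be closed. *)
pose val x v := forall e, 0 < e -> C (x - sc (v - e)) /\ C (sc (v + e) - x).
have val_le x t v : C (x - sc t) -> C (sc v - x) -> t <= v.
  by move=> H1 H2; have := CD _ _ H2 H1; rewrite addrA subrK -rmorphB/= => /Csc; rewrite subr_ge0.
have val_uniq x v w : val x v -> val x w -> v = w.
  suff H v' w' : val x v' -> val x w' -> v' <= w'.
    by move=> ? ?; apply/le_anti; rewrite !H.
  move=> xv xw; apply/ler_addgt0Pr => e e0.
  have e2 : 0 < e / 2 by rewrite divr_gt0.
  have := val_le _ _ _ (xv _ e2).1 (xw _ e2).2; lra.
have valE x : exists v, val x v.
  pose S := [set t | C (x - sc t)].
  have S0 : S (- nrm x).
    by apply: accC; rewrite rmorphN opprK addrC; exact: accretive_nrmD.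
  have Sub : ubound S (nrm x).
    move=> t /val_le; apply; apply: accC.
    by have := accretive_nrmD (- x); rewrite nrmN.
  have supS : has_sup S by split; [exists (- nrm x) | exists (nrm x)].
  exists (sup S) => e e0; split.
    have [t St et] := sup_adherent e0 supS.
    have -> : x - sc (sup S - e) = (x - sc t) + sc (t - (sup S - e)).
      by rewrite (rmorphB sc t) addrA subrK.
    by apply: CD => //; apply: accC; apply: accretive_sc; lra.
  have [|] := Ctot (x - sc (sup S + e)); last by rewrite opprB.
  move=> /(ub_le_sup supS.2); lra.
pose f x := projT1 (cid (valE x)).
have fP x : val x (f x) by rewrite /f; case: cid.
have fE x v : val x v -> f x = v by exact: val_uniq.
have fD x y : f (x + y) = f x + f y.
  apply: fE => e e0; have e2 : 0 < e / 2 by rewrite divr_gt0.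
  have [x1 x2] := fP x _ e2; have [y1 y2] := fP y _ e2; split.
    have := CD _ _ x1 y1; rewrite addrACA -opprD -rmorphD/=; congr (C (_ - sc _)); lra.
  have := CD _ _ x2 y2; rewrite addrACA -opprD -rmorphD/=; congr (C (sc _ - _)); lra.
have fN x : f (- x) = - f x.
  apply: fE => e e0; have [x1 x2] := fP x _ e0; split.
    by rewrite -[- f x - e]opprD rmorphN opprK addrC.
  by rewrite opprK addrC (_ : - f x + e = - (f x - e)) ?rmorphN//; lra.
have f0 : f 0 = 0 by apply: (addrI (f 0)); rewrite -fD !addr0.
have fZ_gt0 r x : 0 < r -> f (sc r * x) = r * f x.
  move=> r0; apply: fE => e e0; have er : 0 < e / r by rewrite divr_gt0.
  have [x1 x2] := fP x _ er; split.
    have := CZ _ _ (ltW r0) x1; rewrite mulrBr -rmorphM/=.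
    by congr (C (_ - sc _)); rewrite mulrBr mulrCA mulfV ?mulr1 ?gt_eqF.
  have := CZ _ _ (ltW r0) x2; rewrite mulrBr -rmorphM/=.
  by congr (C (sc _ - _)); rewrite mulrDr mulrCA mulfV ?mulr1 ?gt_eqF.
have f_ge0 x : C x -> 0 <= f x.
  move=> Cx; apply/ler_addgt0Pr => e e0; apply: (val_le x); last exact: (fP x _ e0).2.
  by rewrite rmorph0 subr0.
exists f; split=> //.
- move=> r x; have [r0|r0|->] := ltrgt0P r; first exact: fZ_gt0.
    rewrite -[r]opprK rmorphN/= mulNr fN fZ_gt0 ?oppr_gt0//; lra.
  by rewrite rmorph0 mul0r f0 mul0r.
- by move=> x /accC; exact: f_ge0.
- apply: fE => e e0; rewrite -(rmorph1 sc) -!rmorphB/=.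
  by split; apply: accC; apply: accretive_sc; lra.
- have [/nCh//|/f_ge0] := Ctot h.
  by rewrite fN oppr_ge0.
Qed.

End Separation.

(** * States from real functionals, and their elementary properties *)

Section StateNorm.
Variables (R : realType) (A : cstarAlgType R).
Implicit Types (a b x y z : A) (r s t e : R) (mu : A -> R[i]).
Local Notation sc := (sc A).

(** The state is the complexification [f a - i f (i a)] of the separating functional. As [f]
    vanishes on skew-adjoint elements, it is real at [a^* a]. *)
Lemma exists_state h : star h = h -> ~ pos h ->
  exists2 mu, states A mu & complex.Re (mu h) <= 0.
Proof.
move=> sh nph; have [f [fD fZ f_ge0 f1 fh]] := separating_functional sh nph.
have fN x : f (- x) = - f x.
  by rewrite -mulN1r -(rmorphN1 sc) fZ mulN1r.
have f_skew x : star x = - x -> f x = 0.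
  move=> sx; have acc0 y : star y = - y -> accretive y.
    by move=> sy; rewrite /accretive/= sy subrr -(rmorph0 sc); exact: pos_sc.
  apply/le_anti; rewrite -oppr_ge0 -fN !f_ge0//; first exact: acc0.
  by apply: acc0; rewrite starN sx.
exists (fun a => f a +i* (- f ('i%C *: a))) => //.
split=> [k a b|a|].
- have kE c : k *: c = sc (complex.Re k) * c + sc (complex.Im k) * ('i%C *: c).
    by rewrite !scE scalerA -scalerDl {1}[k]complexE (mulrC 'i%C).
  have -> : 'i%C *: (k *: a + b) =
      sc (complex.Re k) * ('i%C *: a) - sc (complex.Im k) * a + 'i%C *: b.
    rewrite scalerDr scalerA mulrC -scalerA kE scalerA -[_ * 'i%C]expr2 sqr_i scaleN1r.
    by rewrite mulrN.
  rewrite kE !fD fN !fZ; case: k {kE} => p q /=.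
  apply/eqP; rewrite eq_complex/=; apply/andP; split; apply/eqP; lra.
- have sa : star (star a * a) = star a * a by exact: star_sqr_sa.
  have fi : f ('i%C *: (star a * a)) = 0.
    by apply: f_skew; rewrite starZ sa -scaleNr; congr (_ *: _); simpc.
  rewrite fi oppr0 lecE/= eqxx/=; apply: f_ge0; apply/accretive_sa => //.
  exact: pos_star_sqr.
- by rewrite f1 f_skew ?oppr0// starZ star1 -scaleNr; congr (_ *: _); simpc.
Qed.

Section OneState.
Variables (mu : A -> R[i]) (smu : states A mu).

Lemma stateD a b : mu (a + b) = mu a + mu b.
Proof. by have [/(_ 1 a b)] := smu; rewrite scale1r mul1r. Qed.

Lemma state0 : mu 0 = 0.
Proof. by apply: (addrI (mu 0)); rewrite -stateD !addr0. Qed.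

Lemma stateZ (k : R[i]) a : mu (k *: a) = k * mu a.
Proof. by have [/(_ k a 0)] := smu; rewrite addr0 state0 addr0. Qed.

Lemma stateN a : mu (- a) = - mu a.
Proof. by rewrite -scaleN1r stateZ mulN1r. Qed.

Lemma stateB a b : mu (a - b) = mu a - mu b.
Proof. by rewrite stateD stateN. Qed.

Lemma state1 : mu 1 = 1.
Proof. by case: smu. Qed.

Lemma state_sc r : mu (sc r) = r%:C.
Proof. by rewrite -[sc r]mulr1 scE stateZ state1 mulr1. Qed.

(** [x + e] is a square [w^* w], where [mu] is nonnegative by definition; then [e] tends to 0. *)
Lemma state_pos x : pos x -> 0 <= mu x.
Proof.
move=> px; have H e : 0 < e -> 0 <= mu x + e%:C.
  move=> e0; have [w [pw _ ww]] := pos_sqrt px e0.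
  rewrite -state_sc -stateD -ww -{1}(pos_sa pw).
  by case: smu => _ + _; apply.
rewrite lecE; have := H _ ltr01; rewrite lecE/= => /andP[].
case: (mu x) H => p q /= H; rewrite addr0 => -> _ /=.
by apply/ler_addgt0Pr => e /H; rewrite lecE/= => /andP[].
Qed.

Lemma state_sa_Im x : star x = x -> complex.Im (mu x) = 0.
Proof.
move=> sx; have := state_pos (pos_nrmB sx (lexx _)).
by rewrite stateB state_sc => /ger0_Im; case: (mu x) => p q /=; rewrite sub0r => /eqP; rewrite oppr_eq0 => /eqP.
Qed.

Lemma state_star a : mu (star a) = conjc (mu a).
Proof.
have := state_sa_Im (star_skew_part a); rewrite stateZ stateB.
have : complex.Im (mu (a + star a)) = 0.
  by apply: state_sa_Im; rewrite starD starK addrC.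
rewrite stateD.
case: (mu a) => p q; case: (mu (star a)) => p' q' /= ? ?.
apply/eqP; rewrite eq_complex/=; apply/andP; split; apply/eqP; lra.
Qed.

Lemma state_sa_le x : star x = x -> `|complex.Re (mu x)| <= nrm x.
Proof.
move=> sx; have := state_pos (pos_nrmB sx (lexx _)).
have := state_pos (pos_nrmD sx (lexx _)).
rewrite stateB stateD state_sc !lecE/= => /andP[_ +] /andP[_ +].
by case: (mu x) => p q /= ? ?; rewrite ler_norml; lra.
Qed.

End OneState.
End StateNorm.

(** * Norm estimates by states; homomorphisms are contractive *)

Section StateBounds.
Variable R : realType.
Implicit Types (e : R) (A B : cstarAlgType R).
Local Notation normc := Normc.normc.

Lemma normc_ge_Re (z : R[i]) : `|complex.Re z| <= normc z.
Proof.
by case: z => p q /=; rewrite -sqrtr_sqr ler_wsqrtr// lerDl sqr_ge0.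
Qed.

Lemma normc_le_ReIm (z : R[i]) : normc z <= `|complex.Re z| + `|complex.Im z|.
Proof.
case: z => p q /=; rewrite -ler_sqr ?nnegrE ?sqrtr_ge0 ?addr_ge0//.
rewrite sqr_sqrtr ?addr_ge0 ?sqr_ge0// sqrrD !real_normK ?num_real//.
by rewrite -addrA lerD2l lerDr mulrn_wge0// mulr_ge0.
Qed.

Lemma normc_state_le A (mu : A -> R[i]) a : states A mu ->
  normc (mu a) <= 2 * nrm a.
Proof.
move=> smu; have mus := state_star smu a.
have sX : star (a + star a) = a + star a by rewrite starD starK addrC.
have nX : nrm (a + star a) <= 2 * nrm a.
  by rewrite (le_trans (nrmD _ _))// nrm_star mulr_natl mulr2n.
have nY : nrm ('i%C *: (a - star a)) <= 2 * nrm a.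
  rewrite nrmZ /= expr0n expr1n add0r sqrtr1 mul1r.
  by rewrite (le_trans (nrmB _ _))// nrm_star mulr_natl mulr2n.
have := le_trans (state_sa_le smu sX) nX.
have := le_trans (state_sa_le smu (star_skew_part a)) nY.
rewrite stateZ// stateB// stateD// mus.
apply: (fun P Q => le_trans (normc_le_ReIm _) _); case: (mu a) => p q /=.
by rewrite mul0r sub0r mul1r opprK normrN -!mulr2n !normrMn !mulr2n; lra.
Qed.

Lemma pos_of_states A (x : A) : star x = x ->
  (forall mu, states A mu -> 0 <= complex.Re (mu x)) -> pos x.
Proof.
move=> sx H; apply: pos_closed => e e0; apply: contrapT => nx.
have sxe : star (x + sc A e) = x + sc A e by rewrite starD star_sc sx.
have [mu smu] := exists_state sxe nx.
have := H _ smu; rewrite stateD// state_sc//; case: (mu x) => p q /=; lra.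
Qed.

Lemma nrm_sa_le_states A (x : A) e : star x = x ->
  (forall mu, states A mu -> normc (mu x) <= e) -> nrm x <= e.
Proof.
move=> sx H; have Re_le mu : states A mu -> `|complex.Re (mu x)| <= e.
  by move=> /H; apply: le_trans; exact: normc_ge_Re.
apply: pos_nrm_le; apply: pos_of_states => [|mu smu];
  rewrite ?starB ?starD ?star_sc ?sx// ?stateB ?stateD// state_sc//;
  have := Re_le _ smu; rewrite ler_norml; case: (mu x) => p q /=; lra.
Qed.

(** The self-adjoint bound applies to [a + a^*] and [i (a - a^* )], each at most [2 e]; the factor 2
    comes from this splitting. *)
Lemma nrm_le_states A (a : A) e :
  (forall mu, states A mu -> normc (mu a) <= e) -> nrm a <= 2 * e.
Proof.
move=> H.
have normcJ (z : R[i]) : normc z^* = normc z by case: z => p q /=; rewrite sqrrN.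
have nX : nrm (a + star a) <= e + e.
  apply: nrm_sa_le_states => [|mu smu]; first by rewrite starD starK addrC.
  rewrite stateD// state_star// (le_trans (le_normcD _ _))// normcJ.
  by rewrite lerD ?H.
have nY : nrm ('i%C *: (a - star a)) <= e + e.
  apply: nrm_sa_le_states => [|mu smu]; first exact: star_skew_part.
  rewrite stateZ// stateB// state_star// Normc.normcM /= expr0n expr1n add0r sqrtr1 mul1r.
  by rewrite (le_trans (le_normcD _ _))// normcN normcJ lerD ?H.
rewrite nrmZ /= expr0n expr1n add0r sqrtr1 mul1r in nY.
have : nrm (sc A 2 * a) <= nrm (a + star a) + nrm (a - star a).
  rewrite (rmorph_nat (sc A) 2) mulr_natl mulr2n.
  by rewrite (le_trans _ (nrmD _ _))// addrACA subrr addr0.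
by rewrite nrm_scM ger0_norm//; lra.
Qed.

Section Hom.
Variables (A B : cstarAlgType R) (f : A -> B).
Hypotheses (fhom : star_hom f) (f1 : f 1 = 1).

Lemma state_comp mu : states B mu -> states A (mu \o f).
Proof.
case: fhom => flin fM fS [mulin mupos mu1]; split=> [k a b|a|] /=.
- by rewrite flin mulin.
- by rewrite fM fS.
- by rewrite f1.
Qed.

(** Squaring reduces to the self-adjoint [a^* a], where states bound the norm with constant 1, and
    [mu \o f] is again a state. *)
Lemma hom_nrm_le a : nrm (f a) <= nrm a.
Proof.
case: fhom => flin fM fS; rewrite -ler_sqr ?nnegrE ?nrm_ge0// -!cstarE -fS -fM.
apply: nrm_sa_le_states => [|mu smu]; first by rewrite -fS star_sqr_sa.
have smuf := state_comp smu.
have := state_sa_le smuf (star_sqr_sa a); have := state_sa_Im smuf (star_sqr_sa a).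
move=> /= Im0; apply: le_trans; rewrite (le_trans (normc_le_ReIm _))//.
by rewrite Im0 normr0 addr0.
Qed.

End Hom.
End StateBounds.

(** * States pulled back along words and paths *)

Section WordStates.
Variables (R : realType) (M : mauldin_williams R).
Implicit Types (v : vertex M) (e : edge M) (w : seq (edge M)).
Local Notation normc := Normc.normc.
Local Notation fns v := (mw_alg (v : vertex M) -> R[i]).

(* Pulling states back along edges, rather than composing the homomorphisms along
   a path, avoids transporting elements between the algebras at [rng (alpha i)]
   and [src (alpha i.+1)]. *)
Inductive edge_image e (F : forall v, set (fns v)) : forall v, set (fns v) :=
  EdgeImage nu : F (rng e) nu -> edge_image e F (nu \o mw_phi M e).

(** The states [mu o phi_w]; the set at [v] is empty if [w] is nonempty and is not a path starting
    at [v]. *)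
Fixpoint word_states w : forall v, set (fns v) :=
  if w is e :: w' then edge_image e (word_states w')
  else fun v => states (mw_alg v).

(** Inversion at the index [src e]: vertices have decidable equality, so the transport along a loop
    is trivial. *)
Lemma edge_image_src e F (mu : fns (src e)) :
  edge_image e F mu -> exists2 nu, F (rng e) nu & mu = nu \o mw_phi M e.
Proof.
suff H v (mu' : fns v) : edge_image e F mu' -> forall E : v = src e,
    exists2 nu, F (rng e) nu &
      eq_rect v (fun u => fns u) mu' (src e) E = nu \o mw_phi M e.
  by move=> /H/(_ erefl).
by case=> nu Fnu E; exists nu => //; rewrite (eq_axiomK E).
Qed.

Lemma word_states_states w v (mu : fns v) :
  word_states w mu -> states (mw_alg v) mu.
Proof.
elim: w v mu => [//|e w IH] v mu; case=> nu /IH snu.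
exact: state_comp (mw_phi_hom e) (mw_phi1 e) _ snu.
Qed.

Lemma word_states_cat w w' v (mu : fns v) :
  word_states (w ++ w') mu -> word_states w mu.
Proof.
elim: w v mu => [|e w IH] v mu; first exact: word_states_states.
by case=> nu Fnu; apply: EdgeImage; exact: IH.
Qed.

Lemma rieffel_dist_word : exists c D : R, [/\ 0 <= c < 1, 0 <= D &
  forall w v (mu nu : fns v), word_states w mu -> word_states w nu ->
    (rieffel_dist (mw_lip v) mu nu <= (c ^+ size w * D)%:E)%E].
Proof.
have [c [c0 c1 ctr]] := mw_contr M.
have /choice[D DP] v : exists D, forall mu nu : fns v, states _ mu -> states _ nu ->
    (rieffel_dist (mw_lip v) mu nu <= D%:E)%E.
  exact: rieffel_bounded (mw_lip v).
(* Summing over the finitely many vertices makes one diameter bound serve all of them. *)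
exists c, (\sum_v `|D v|); split; [by rewrite ltW | exact: sumr_ge0 |].
elim=> [|e w IH] v mu nu.
  move=> /DP H /H; rewrite expr0 mul1r => /le_trans; apply; rewrite lee_fin.
  by rewrite (le_trans (ler_norm _))// (bigD1 v)//= lerDl sumr_ge0.
move=> wmu; case: wmu nu => mu' Hmu' nu /edge_image_src[nu' Hnu' ->].
apply: le_trans (ctr e _ _ (word_states_states Hmu') (word_states_states Hnu')) _.
rewrite /= exprS -mulrA [leRHS]EFinM lee_pmul2l ?lte_fin//.
exact: IH.
Qed.

Lemma rieffel_dist_ge v (l : lipschitz_structure (mw_alg v)) (mu nu : fns v) x r :
  states _ mu -> states _ nu -> lip_elt l x ->
  (rieffel_dist l mu nu <= r%:E)%E ->
  normc (mu x - nu x) <= (lip_norm l x + 1) * r.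
Proof.
move=> smu snu lx Hr.
have L0 : 0 <= lip_norm l x.
  have l0 : lip_norm l 0 = 0.
    by have := lip_normZ 0 lx; rewrite scale0r Normc.normc0 mul0r.
  have lN : lip_elt l (- x).
    by have := lip_eltP (-1) lx (lip_elt0 l); rewrite scaleN1r addr0.
  have := lip_normD lx lN; have := lip_normZ (-1) lx.
  by rewrite scaleN1r normcN Normc.normc1 mul1r => ->; rewrite subrr l0; lra.
have L1 : 0 < lip_norm l x + 1 by rewrite ltr_wpDl.
(* the [+ 1] covers the case [lip_norm l x = 0] *)
set k := (lip_norm l x + 1)^-1.
have k0 : 0 < k by rewrite invr_gt0.
have nk : normc k%:C = k by rewrite /= expr0n addr0 sqrtr_sqr gtr0_norm.
have lk : lip_elt l (k%:C *: x).
  by have := lip_eltP k%:C lx (lip_elt0 l); rewrite addr0.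
have : ((normc (mu (k%:C *: x) - nu (k%:C *: x)))%:E <= r%:E)%E.
  apply: le_trans Hr; apply: ereal_sup_ubound; exists (k%:C *: x) => //.
  by split => //; rewrite lip_normZ// nk /k mulrC ler_pdivrMr// mul1r lerDl.
rewrite lee_fin !stateZ// -mulrBr Normc.normcM nk /k.
by rewrite mulrC ler_pdivrMr// mulrC.
Qed.

(** A Lipschitz [y] within [e / 8] of [x] costs [e / 4] for each of the two states, and the Rieffel
    bound makes the difference at [y] at most [e / 2]. [N] does not depend on the word, which later
    gives continuity. *)
Lemma word_states_mixing v (x : mw_alg v) (e : R) : 0 < e -> exists N, forall w,
  (N <= size w)%N -> forall mu nu : fns v, word_states w mu -> word_states w nu ->
    normc (mu x - nu x) <= e.
Proof.
move=> e0; have [c [D [/andP[c0 c1] D0 cD]]] := rieffel_dist_word.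
have e8 : 0 < (e / 8)%:C :> R[i] by rewrite ltcR divr_gt0.
have [y [xy ly]] : ball x (e / 8)%:C `&` lip_elt (mw_lip v) !=set0.
  apply: (lip_dense (mw_lip v)); last exact: ball_open.
  by exists x; exact: ballxx.
have xy8 : nrm (x - y) <= e / 8.
  by move: xy; rewrite -ball_normE/= nrmE ltcR => /ltW.
set L := (lip_norm (mw_lip v) y + 1) * D.
have [N cN] : exists N, `|L| * c ^+ N <= e / 2.
  have d0 : 0 < e / 2 / (`|L| + 1) by rewrite !divr_gt0// ltr_wpDl.
  have := @cvg_expr R c; rewrite ger0_norm// => /(_ c1).
  move=> /cvgrPdist_lt /(_ _ d0)[N _ /(_ N (leqnn N))].
  rewrite sub0r normrN ger0_norm ?exprn_ge0// => H; exists N.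
  have L1 : 0 < `|L| + 1 by rewrite ltr_wpDl.
  apply: le_trans (_ : (`|L| + 1) * c ^+ N <= _).
    by rewrite ler_wpM2r ?exprn_ge0// lerDl.
  by rewrite mulrC -ler_pdivlMr// ltW.
exists N => w Nw mu nu wmu wnu.
have smu := word_states_states wmu; have snu := word_states_states wnu.
have xE (f : fns v) : states _ f -> f x = f (x - y) + f y.
  by move=> sf; rewrite -stateD// subrK.
rewrite (xE _ smu) (xE _ snu) opprD addrACA.
have H1 : normc (mu (x - y)) <= e / 4.
  by rewrite (le_trans (normc_state_le _ smu))//; lra.
have H2 : normc (- nu (x - y)) <= e / 4.
  by rewrite normcN (le_trans (normc_state_le _ snu))//; lra.
have H3 : normc (mu y - nu y) <= e / 2.
  rewrite (le_trans (rieffel_dist_ge smu snu ly (cD _ _ _ _ wmu wnu)))//.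
  rewrite mulrCA mulrC (le_trans _ cN)// (le_trans (ler_norm _))// normrM.
  by rewrite (ger0_norm (exprn_ge0 _ c0)) ler_wpM2l// ler_wiXn2l// ltW.
have := le_normcD (mu (x - y) - nu (x - y)) (mu y - nu y).
have := le_normcD (mu (x - y)) (- nu (x - y)).
lra.
Qed.

(** At the empty word all states of [a - k] are small, so its norm is at most [2 d]. The induction
    removes the first edge by multiplicativity and contractivity of its homomorphism. *)
Lemma near_scalar_mul w v (a : mw_alg v) (k : R[i]) (d : R) :
  (forall mu, word_states w mu -> normc (mu a - k) <= d) ->
  forall (mu : fns v) b, word_states w mu ->
    normc (mu (a * b) - k * mu b) <= 4 * d * nrm b.
Proof.
elim: w v a => [|e w IH] v a Ha mu b wmu.
  have -> : mu (a * b) - k * mu b = mu ((a - k%:A) * b).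
    by rewrite mulrBl -scalerAl mul1r stateB// stateZ.
  rewrite (le_trans (normc_state_le _ wmu))//.
  have : nrm (a - k%:A) <= 2 * d.
    apply: nrm_le_states => nu snu; rewrite stateB// stateZ// state1// mulr1.
    exact: Ha.
  move=> /(ler_wpM2r (nrm_ge0 b)); have := nrmM (a - k%:A) b; lra.
move: wmu a Ha b; case=> nu wnu a Ha b /=.
have [_ fM _] := mw_phi_hom e; rewrite fM.
have Ha' nu' : word_states w nu' -> normc (nu' (mw_phi M e a) - k) <= d.
  by move=> wnu'; apply: (Ha (nu' \o _)); exact: EdgeImage.
rewrite (le_trans (IH _ _ Ha' _ _ wnu))// ler_wpM2l//.
  rewrite mulr_ge0// (le_trans _ (Ha' _ wnu))//.
  by case: (_ - _) => p q; exact: sqrtr_ge0.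
exact: hom_nrm_le (mw_phi_hom e) (mw_phi1 e) _.
Qed.

End WordStates.

(** * Limits in the topology of pointwise convergence *)

Section PointwiseConvergence.
Variable R : realType.
Local Notation normc := Normc.normc.

Lemma normc_eq0_limit (z : R[i]) : (forall e : R, 0 < e -> normc z <= e) -> z = 0.
Proof.
move=> H; apply/Normc.eq0_normc/le_anti; apply/andP; split.
  by apply/ler_addgt0Pr => e /H; rewrite add0r.
by case: z {H} => p q; exact: sqrtr_ge0.
Qed.

Lemma normc_dist_closed (z k : R[i]) (d : R) :
  (forall e : R, 0 < e -> exists2 z', normc (z - z') <= e & normc (z' - k) <= d) ->
  normc (z - k) <= d.
Proof.
move=> H; apply/ler_addgt0Pr => e /H[z' z1 z2].
by rewrite -(subrK z' z) -addrA (le_trans (le_normcD _ _))// [leRHS]addrC lerD.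
Qed.

Lemma eval_nbhs (T : choiceType) (mu : T -> R[i]) x (e : R) : 0 < e ->
  nbhs (mu : {ptws T -> R[i]}) [set nu | normc (mu x - nu x) <= e].
Proof.
move=> e0.
have H : nbhs (mu x) [set z : R[i] | normc (mu x - z) <= e].
  have e0' : 0 < e%:C :> R[i] by rewrite ltcR.
  apply: filterS (nbhsx_ballx (mu x) _ e0') => z.
  rewrite -ball_normE /= => /ltW.
  by rewrite normc_def lecR; case: (_ - _).
exact: (@proj_continuous _ (fun _ => R[i]) x mu _ H).
Qed.

End PointwiseConvergence.

(** * Paths and their limit states *)

Section Coding.
Variables (R : realType) (M : mauldin_williams R).
Variable K : forall v : vertex M, set (mw_alg v -> R[i]).
Arguments K v _ : clear implicits.
Hypothesis HK : invariant_family K.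
Implicit Types (v : vertex M) (alpha : nat -> edge M).
Local Notation normc := Normc.normc.
Local Notation fns v := (mw_alg (v : vertex M) -> R[i]).

Definition is_path alpha := forall i, rng (alpha i) = src (alpha i.+1).

Lemma invariant_states v mu : K v mu -> states (mw_alg v) mu.
Proof. by have [_ + _ _] := HK v; apply. Qed.

(** A point of [K] at the end of the segment is pulled back edge by edge; invariance keeps it in
    [K]. *)
Lemma invariant_word n alpha v : is_path alpha -> v = src (alpha 0%N) ->
  exists2 mu, K v mu & word_states (mkseq alpha n) mu.
Proof.
elim: n alpha v => [|n IH] alpha v pa v0.
  by have [[mu Kmu] _ _ _] := HK v; exists mu => //; exact: invariant_states.
have [nu Knu wnu] := IH (alpha \o succn) _ (fun i => pa i.+1) (pa 0%N).
rewrite v0; exists (nu \o mw_phi M (alpha 0%N)).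
  by have [_ _ _ ->] := HK (src (alpha 0%N)); exact: DualImage.
have -> : mkseq alpha n.+1 = alpha 0%N :: mkseq (alpha \o succn) n.
  by rewrite /mkseq /= (iotaDl 1 0) -map_comp.
exact: EdgeImage.
Qed.

(* [mu] is in the pointwise closure of the states pulled back along each initial
   segment of [alpha], expressed by the oscillation bounds it inherits. *)
Definition limit_state alpha v (mu : fns v) := states _ mu /\
  forall n x d,
    (forall mu1 mu2 : fns v, word_states (mkseq alpha n) mu1 ->
       word_states (mkseq alpha n) mu2 -> normc (mu1 x - mu2 x) <= d) ->
    forall nu, word_states (mkseq alpha n) nu -> normc (mu x - nu x) <= d.

(** Compactness of [K v] gives a cluster point of the states from [invariant_word]. Those of longer
    segments also belong to each shorter one, so the cluster point inherits its bounds. *)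
Lemma limit_state_exists alpha v : is_path alpha -> v = src (alpha 0%N) ->
  exists mu : fns v, limit_state alpha mu.
Proof.
move=> pa v0.
have /choice[f fP] n : exists mu : fns v, K v mu /\ word_states (mkseq alpha n) mu.
  by have [mu] := invariant_word n pa v0; exists mu.
have [_ _ Kcpt _] := HK v.
have [|mu [Kmu clmu]] := Kcpt (f n @[n --> \oo]) _.
  by exists 0%N => // n _; exact: (fP n).1.
exists mu; split=> [|n x d Hd nu wnu]; first exact: invariant_states.
apply: normc_dist_closed => e e0.
have [|_ [[m nm <-] Hm]] := clmu (f @` [set m | (n <= m)%N]) _ _ (eval_nbhs mu x e0).
  by exists n => // m nm; exists m.
exists (f m x) => //; apply: Hd => //.
apply: (@word_states_cat _ _ _ (mkseq (fun i => alpha (n + i)%N) (m - n))).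
suff -> : mkseq alpha n ++ mkseq (fun i => alpha (n + i)%N) (m - n) = mkseq alpha m.
  exact: (fP m).2.
have E : iota n (m - n) = map (addn n) (iota 0 (m - n)) by rewrite -iotaDl addn0.
by rewrite -{2}(subnKC nm) /mkseq iotaD map_cat add0n E -map_comp.
Qed.

Lemma limit_state_mul alpha v (mu : fns v) a b : is_path alpha ->
  v = src (alpha 0%N) -> limit_state alpha mu -> mu (a * b) = mu a * mu b.
Proof.
move=> pa v0 [smu lmu]; apply: subr0_eq; apply: normc_eq0_limit => e e0.
(* The terms of [C] count the errors at [a * b], in [near_scalar_mul], and at [b] multiplied by
   [mu a]. *)
set C := 1 + 4 * nrm b + normc (mu a).
have na0 : 0 <= normc (mu a) by case: (mu a) => p q; exact: sqrtr_ge0.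
have C0 : 0 < C.
  by rewrite /C; have := nrm_ge0 b; lra.
have d0 : 0 < e / C by rewrite divr_gt0.
set d := e / C in d0.
have [N1 HN1] := word_states_mixing a d0; have [N2 HN2] := word_states_mixing b d0.
have [N3 HN3] := word_states_mixing (a * b) d0.
pose n := (N1 + N2 + N3)%N.
have [nu _ wnu] := invariant_word n pa v0.
have sn : size (mkseq alpha n) = n by exact: size_mkseq.
have ca nu' : word_states (mkseq alpha n) nu' -> normc (nu' a - mu a) <= d.
  move=> wnu'; rewrite -normcN opprB; apply: lmu wnu'; apply: HN1.
  by rewrite sn /n -addnA leq_addr.
have cb : normc (mu b - nu b) <= d.
  by apply: lmu wnu; apply: HN2; rewrite sn /n addnAC leq_addl.
have cab : normc (mu (a * b) - nu (a * b)) <= d.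
  by apply: lmu wnu; apply: HN3; rewrite sn /n leq_addl.
have nm := near_scalar_mul ca b wnu.
have -> : mu (a * b) - mu a * mu b = (mu (a * b) - nu (a * b)) +
   ((nu (a * b) - mu a * nu b) + mu a * (nu b - mu b)).
  by ring.
rewrite (le_trans (le_normcD _ _))//.
have := le_normcD (nu (a * b) - mu a * nu b) (mu a * (nu b - mu b)).
rewrite Normc.normcM -(normcN (nu b - mu b)) opprB.
have := ler_wpM2l na0 cb.
have : e = d * C by rewrite /d divfK// gt_eqF.
by rewrite /C; lra.
Qed.

Lemma limit_state_eq alpha v (mu : fns v) x :
  (forall n, word_states (mkseq alpha n) mu) ->
  forall mu' : fns v, limit_state alpha mu' -> mu' x = mu x.
Proof.
move=> wmu mu' [_ lmu']; apply: subr0_eq; apply: normc_eq0_limit => e e0.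
have [N HN] := word_states_mixing x e0.
by apply: (lmu' N) => //; apply: HN; rewrite size_mkseq.
Qed.

Lemma path_of_invariant v (mu : fns v) : K v mu -> exists alpha,
  [/\ is_path alpha, src (alpha 0%N) = v & forall n, word_states (mkseq alpha n) mu].
Proof.
(* A point of [K] is bundled with its vertex, so that invariance can be unfolded forever by
   iterating one choice function. *)
pose T := {p : {v : vertex M & fns v} | K (projT1 p) (projT2 p)}.
have /choice[g gP] (t : T) : exists p : edge M * T,
    [/\ src p.1 = projT1 (sval t), rng p.1 = projT1 (sval p.2) &
     forall w, word_states w (projT2 (sval p.2)) ->
       word_states (p.1 :: w) (projT2 (sval t))].
  case: t => -[u nu] /= Knu.
  have : dual_image K u nu by have [_ _ _ <-] := HK u.
  by case=> e nu' Knu'; exists (e, exist _ (existT _ (rng e) nu') Knu'); split.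
move=> Kmu; pose t0 : T := exist _ (existT _ v mu) Kmu.
pose st (t : T) := (g t).2; pose t n := iter n st t0.
exists (fun n => (g (t n)).1); split=> [i||n].
- by have [_ -> _] := gP (t i); have [-> _ _] := gP (t i.+1).
- by have [-> _ _] := gP t0.
- suff H m (s : T) : word_states
      (mkseq (fun i => (g (iter i st s)).1) m) (projT2 (sval s)).
    exact: (H n t0).
  elim: m s => [|m IH] s.
    by apply: invariant_states; exact: (svalP s).
  have -> : mkseq (fun i => (g (iter i st s)).1) m.+1 =
      (g s).1 :: mkseq (fun i => (g (iter i st (st s))).1) m.
    rewrite /mkseq /= (iotaDl 1 0) -map_comp; congr (_ :: _).
    by apply: eq_map => i; rewrite [LHS]/comp add1n iterSr.
  by have [_ _] := gP s; apply; exact: IH.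
Qed.

End Coding.

(** * Cylinder neighbourhoods in the path space, and the embedding *)

Section PathSpace.
Variable G : graph.

Definition edges (alpha : path_space G) : nat -> edge G := set_val alpha.

Lemma edges_path (alpha : path_space G) i :
  rng (edges alpha i) = src (edges alpha i.+1).
Proof. by have := set_valP alpha; apply. Qed.

Lemma edges_mkseq_nbhs (alpha : path_space G) n :
  nbhs alpha [set beta | mkseq (edges beta) n = mkseq (edges alpha) n].
Proof.
elim: n => [|n IH]; first by apply: filterS filterT.
have Hn : nbhs alpha [set beta | edges beta n = edges alpha n].
  have := @initial_continuous _ _ (set_val : path_space G -> {ptws nat -> discrete_topology (edge G)}) alpha.
  move=> /(_ [set f | f n = edges alpha n]); apply.
  apply: (@proj_continuous _ (fun _ => discrete_topology (edge G)) n _ [set edges alpha n]).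
  exact: discrete_set1.
apply: filterS (filterI IH Hn) => beta [/= H1 H2].
by rewrite !mkseqS H1 H2.
Qed.

End PathSpace.

Lemma continuousC_normc (R : realType) (X : topologicalType) (f : X -> R[i]) :
  (forall x (e : R), 0 < e -> nbhs x [set y | Normc.normc (f x - f y) <= e]) ->
  f \in @continuousC R X.
Proof.
move=> H; apply/mem_set => x; apply/cvgrPdist_le => e.
case: e => e e' /[dup] /ltW/ger0_Im/= ->; rewrite ltcE/= => /andP[_ e0].
by apply: filterS (H x e e0) => y /=; rewrite normc_def lecR; case: (_ - _).
Qed.

(** The functionals vanishing at [a] form a pointwise closed convex set, which therefore contains
    the hull of [K]. *)
Lemma states_eq0 (R : realType) (A : cstarAlgType R) (K : set (A -> R[i])) a :
  states A = closed_convex_hull K -> (forall mu, K mu -> mu a = 0) -> a = 0.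
Proof.
move=> hullK Ka; pose B : set (A -> R[i]) := [set mu | mu a = 0].
have BS : states A `<=` B.
  rewrite hullK; apply: smallest_sub => //; split.
    move=> mu clB; apply: normc_eq0_limit => e e0.
    have [nu [Bnu]] := clB _ (eval_nbhs mu a e0).
    by rewrite /= (Bnu : nu a = 0) subr0.
  move=> mu nu l /set_mem mua /set_mem nua; apply/mem_set; rewrite /B/=.
  rewrite -[LHS]/(l%:inum * mu a + (1 - l%:inum) * nu a) (mua : mu a = 0) (nua : nu a = 0).
  by rewrite !mulr0 addr0.
apply: nrm_eq0; apply/le_anti; rewrite nrm_ge0 andbT -(mulr0 2).
by apply: nrm_le_states => mu /BS ->; rewrite Normc.normc0.
Qed.


Theorem theorem3p5 (R : realType) (M : mauldin_williams R)
    (HG : no_sinks M)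
    (K : forall v : vertex M, set (mw_alg v -> R[i]))
    (HK : invariant_family K)
    (Hhull : forall v : vertex M,
       states (mw_alg v) = closed_convex_hull (K v)) :
  exists Phi : direct_sum (fun v : vertex M => mw_alg v) ->
               Cfun R (path_space M),
    star_hom Phi /\ injective Phi.
Proof.
(* The value 0 off paths or away from the source is a default making the choice total. *)
have HM alpha v : exists mu : mw_alg (v : vertex M) -> R[i],
    is_path alpha -> v = src (alpha 0%N) -> limit_state alpha mu.
  have [[pa v0]|nH] := pselect (is_path alpha /\ v = src (alpha 0%N)).
    by have [mu] := limit_state_exists HK pa v0; exists mu.
  by exists (fun=> 0) => pa v0; case: nH.
pose m alpha v := projT1 (cid (HM alpha v)).
have mP alpha : is_path alpha -> limit_state alpha (m alpha (src (alpha 0%N))).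
  by move=> pa; rewrite /m; case: cid => mu /=; apply.
pose V (a : direct_sum (fun v : vertex M => mw_alg v)) alpha :=
  m alpha (src (alpha 0%N)) (a (src (alpha 0%N))).
have cV a : (fun alpha : path_space M => V a (edges alpha)) \in @continuousC R (path_space M).
  apply: continuousC_normc => alpha e e0.
  have e2 : 0 < e / 2 by rewrite divr_gt0.
  have pa := edges_path alpha.
  have [N HN] := word_states_mixing (a (src (edges alpha 0%N))) e2.
  (* With [N + 1] edges in common there is at least one, so both paths start at the same vertex. *)
  apply: filterS (edges_mkseq_nbhs alpha N.+1) => beta /= Hb.
  have b0 : edges beta 0%N = edges alpha 0%N.
    by have := congr1 (fun s => nth (edges alpha 0%N) s 0%N) Hb; rewrite !nth_mkseq.
  have [_ lb] := mP _ (edges_path beta); have [_ la] := mP _ pa.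
  have [nu _ wnu] := invariant_word HK N.+1 pa (erefl _).
  rewrite /V; rewrite b0 in lb *.
  have sN : (N <= size (mkseq (edges alpha) N.+1))%N by rewrite size_mkseq.
  have Ha := la N.+1 _ _ (HN _ sN) _ wnu.
  have Hbb := lb N.+1 (a (src (edges alpha 0%N))) (e / 2).
  rewrite Hb in Hbb; have {}Hbb := Hbb (HN _ sN) _ wnu.
  have := le_normcD (m (edges alpha) (src (edges alpha 0%N)) (a (src (edges alpha 0%N))) -
    nu (a (src (edges alpha 0%N)))) (nu (a (src (edges alpha 0%N))) -
    m (edges beta) (src (edges alpha 0%N)) (a (src (edges alpha 0%N)))).
  rewrite addrA subrK -(normcN (nu _ - _)) opprB.
  move=> /le_trans; apply; by rewrite [leRHS](splitr e) lerD.
exists (fun a => MkCfun (cV a)); split; first split.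
- move=> k a b; apply/val_inj/funext => alpha /=.
  have [sm _] := mP _ (edges_path alpha).
  by case: sm => + _ _; apply.
- move=> a b; apply/val_inj/funext => alpha /=.
  exact: (limit_state_mul HK (a _) (b _) (edges_path alpha) erefl (mP _ (edges_path alpha))).
- move=> a; apply/val_inj/funext => alpha /=.
  have [sm _] := mP _ (edges_path alpha).
  exact: state_star.
move=> a b ab; apply: functional_extensionality_dep => v; apply: subr0_eq.
apply: (states_eq0 (Hhull v)) => mu Kmu.
(* Evaluating at a path that codes [mu] recovers [mu] on the component at [v]. *)
have [alpha [pa v0 wmu]] := path_of_invariant HK Kmu.
have smu := invariant_states HK Kmu; rewrite stateB//.
pose p : path_space M := SigSub (mem_set pa : alpha \in _).
have := congr1 (fun f : Cfun R (path_space M) => f p) ab.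
rewrite /= /V (_ : edges p = alpha)//.
have := mP _ pa; case: _ / v0 mu Kmu wmu smu => mu Kmu wmu smu lmu.
have E x := limit_state_eq x wmu lmu.
by rewrite !E => ->; rewrite subrr.
Qed.
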